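(* Let $M$ be a hyperkähler manifold with a local system of special coordinates anchored at $I_0$ (of either of the two types described in the context), and for a differentiable function $f$ let $X_f$ be the corresponding symplectic gradient-like vector field. A sequence of functions $\{f_n\}_{n\in\mathbb{Z}}$ on $M$ forms a chain of hyperpotentials with respect to the complex structure $I_0$ if and only if $$\iota_{X_{f_{n-1}}}\omega_++\iota_{X_{f_n}}\omega_0+\iota_{X_{f_{n+1}}}\omega_-=df_n$$ for all $n\in\mathbb{Z}$.
   Context: Hyperkähler conventions. $M$ is a smooth manifold of real dimension $4m$ with symplectic forms $\omega_1,\omega_2,\omega_3$ such that (as maps $TM\to T^*M$) $I_1=\omega_3^{-1}\omega_2$, $I_2=\omega_1^{-1}\omega_3$, $I_3=\omega_2^{-1}\omega_1$ satisfy $I_1^2=I_2^2=I_3^2=I_1I_2I_3=-1$; $\omega_i(X,Y)=g(X,I_iY)$. Put $I_+=\tfrac12(I_1+iI_2)$, $I_0=I_3$, $I_-=-\tfrac12(I_1-iI_2)$, $\omega_+=\tfrac12(\omega_1+i\omega_2)$, $\omega_0=\omega_3$, $\omega_-=-\tfrac12(\omega_1-i\omega_2)$. Endomorphisms act on 1-forms from the right, $(\alpha I)(X)=\alpha(IX)$. The twistor space is $\mathcal{Z}=M\times S^2$ with complex structure $I(\mathbf{u})\oplus I_{\mathbb{CP}^1}$ at $(x,\mathbf{u})$, where $I(\mathbf{u})=\sum x_kI_k$ and $\zeta=-\frac{x_1+ix_2}{1+x_3}$ is the complex coordinate on $S^2\cong\mathbb{CP}^1$ ($\zeta=0$ labels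 $I_0$). Chain of hyperpotentials with respect to $I_0$: a sequence $(f_n)_{n\in\mathbb{Z}}$ of complex functions sharing a non-trivial common domain on which $df_{n-1}I_++df_nI_0+df_{n+1}I_-=0$ for all $n$; equivalently $\bar\partial f_nI_+=-i\,\partial f_{n+1}$ for all $n$, with $\partial,\bar\partial$ the Dolbeault operators of $I_0$. Special coordinates. On an open set $V_N\subset\mathcal{Z}$ meeting the fiber $\zeta=0$, choose local holomorphic functions $\eta^A,\tilde\eta_A$ ($A=1,\dots,m$) that are Darboux coordinates for the fiberwise form $\omega_{V_N}=\omega_++\omega_0\zeta+\omega_-\zeta^2=d\tilde\eta_A\wedge d\eta^A$ ($d$ along $M$; repeated indices summed), with Taylor expansions $\eta^A=z^A+v^A\zeta+\mathcal{O}(\zeta^2)$, $\tilde\eta_A=u_A+w_A\zeta+\mathcal{O}(\zeta^2)$; so $\omega_+=du_A\wedge dz^A$ and $\omega_0=du_A\wedge dv^A+dw_A\wedge dz^A$. Type 1 (none of the $v^A$ real): the special coordinates on $M$ are $z^A,v^A,\bar z^A,\bar v^A$. Then, with $\rho^{AB}$ the matrix inverse of $\rho_{AB}=-i\,\frac{\partial u_A}{\partial\bar v^B}=i\,\frac{\partial\bar u_B}{\partial v^A}$, $$X_f=i\rho^{AB}\Big(\frac{\partial f}{\partial\bar v^A}\frac{\partial}{\partial v^B}-\frac{\partial f}{\partial v^B}\frac{\partial}{\partial\bar v^A}\Big).$$ Type 2 (all $v^A$ real): write $v^A=\psi^A$ and take $\eta^A=z^A+\psi^A\zeta-\bar z^A\zeta^2$;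 set $\tilde\psi_A=\mathrm{Re}\,u_A-\varrho_A$ with $\varrho_A$ real functions independent of the $\tilde\psi_B$ and satisfying $\frac{\partial\varrho_A}{\partial\psi^B}=\frac{\partial\varrho_B}{\partial\psi^A}$; the special coordinates are $z^A,\bar z^A,\psi^A,\tilde\psi_A$. Then $$X_f=\frac{\partial f}{\partial\psi^A}\frac{\partial}{\partial\tilde\psi_A}-\frac{\partial f}{\partial\tilde\psi_A}\frac{\partial}{\partial\psi^A}.$$ *)

(* Defs.v *)
(* MathComp-Analysis, over an arbitrary [R : realType]; complex numbers are
   [R[i]]. *)
From mathcomp Require Import all_boot all_order all_algebra.
From mathcomp Require Import complex.
From mathcomp Require Import all_classical all_reals all_analysis.

Set Implicit Arguments.
Unset Strict Implicit.
Unset Printing Implicit Defensive.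

Import Order.TTheory GRing.Theory Num.Theory numFieldNormedType.Exports.
Local Open Scope classical_set_scope.
Local Open Scope ring_scope.
Local Open Scope complex_scope.

Section Calculus.
Variables (R : realType) (k : nat).
Implicit Types (W : set 'rV[R]_k) (g : 'rV[R]_k -> R) (F : 'rV[R]_k -> R[i]).

Definition partial (i : 'I_k) g : 'rV[R]_k -> R :=
  fun x => 'D_(delta_mx 0 i) g x.

(* C^oo on the open set W: every iterated partial derivative exists and is
   continuous at every point of W. *)
Definition smooth_on W g := forall (s : seq 'I_k) x, W x ->
  {for x, continuous (foldr partial g s)} /\
  (forall i, derivable (foldr partial g s) x (delta_mx 0 i)).

Definition reF F : 'rV[R]_k -> R := fun x => complex.Re (F x).
Definition imF F : 'rV[R]_k -> R := fun x => complex.Im (F x).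

Definition csmooth_on W F := smooth_on W (reF F) /\ smooth_on W (imF F).

Definition grad F (x : 'rV[R]_k) : 'rV[R[i]]_k :=
  \row_i (partial i (reF F) x +i* partial i (imF F) x).

End Calculus.

Definition cmx (R : realType) (p q : nat) (A : 'M[R]_(p, q)) : 'M[R[i]]_(p, q) :=
  map_mx (fun x => x%:C) A.

(* [chart_inv a] is only meaningful on the image [chart a @` dom a]. *)
Record smoothManifold (R : realType) (n : nat) := SmoothManifold {
  space :> topologicalType;
  chart_index : Type;
  dom : chart_index -> set space;
  chart : chart_index -> space -> 'rV[R]_n;
  chart_inv : chart_index -> 'rV[R]_n -> space;
  space_hausdorff : hausdorff_space space;
  space_second_countable : @second_countable space;
  dom_open : forall a, open (dom a);
  dom_cover : forall p, exists a, dom a p;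
  image_open : forall a, open (chart a @` dom a);
  chartK : forall a p, dom a p -> chart_inv a (chart a p) = p;
  chart_continuous : forall a, {within dom a, continuous (chart a)};
  chart_inv_continuous :
    forall a, {within chart a @` dom a, continuous (chart_inv a)};
  transition_smooth : forall a b j,
    smooth_on (chart a @` (dom a `&` dom b))
              (fun x => chart b (chart_inv a x) 0 j)
}.

Section Manifold.
Variables (R : realType) (n : nat) (M : smoothManifold R n).
Implicit Types (a b : chart_index M) (p : M) (f : M -> R[i]) (U : set M).

Definition in_chart a f : 'rV[R]_n -> R[i] := fun x => f (chart_inv a x).

(* Components of the (complexified) covector df_p in the chart a. *)
Definition diff_in a f p : 'rV[R[i]]_n := grad (in_chart a f) (chart a p).

Definition csmooth U f :=
  forall a, csmooth_on (chart a @` (U `&` dom a)) (in_chart a f).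

Definition differentiable_fun U f := forall a p, U p -> dom a p ->
  differentiable (reF (in_chart a f)) (chart a p) /\
  differentiable (imF (in_chart a f)) (chart a p).

(* Entry (j, i) is the partial derivative of the j-th coordinate of the chart b
   with respect to the i-th coordinate of the chart a. *)
Definition transition_jac a b p : 'M[R]_n :=
  \matrix_(j, i) partial i (fun x => chart b (chart_inv a x) 0 j) (chart a p).

(* Covariant 2-tensor fields, given by their components
   [t a p i j] = t(d/dx^i, d/dx^j) in every chart. *)
Record tensor2 := Tensor2 {
  tcomp :> chart_index M -> M -> 'M[R]_n;
  tensor2_transform : forall a b p, dom a p -> dom b p ->
    tcomp a p = (transition_jac a b p)^T *m tcomp b p *m transition_jac a b p;
  tensor2_smooth : forall a i j,
    smooth_on (chart a @` dom a) (fun x => tcomp a (chart_inv a x) i j)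
}.

Definition symplectic (w : tensor2) := forall a p, dom a p ->
  [/\ (w a p)^T = - w a p,
      w a p \in unitmx
    & forall i j l,
        let D e r s :=
          partial e (fun x => w a (chart_inv a x) r s) (chart a p) in
        D i j l + D j l i + D l i j = 0].

Definition riemannian (g : tensor2) := forall a p, dom a p ->
  (g a p)^T = g a p /\
  (forall X : 'cV[R]_n, X != 0 -> 0 < (X^T *m g a p *m X) 0 0).

(* Tangent vectors are columns and covectors rows, so that the right action
   alpha I of endomorphisms on 1-forms is [alpha *m I].  This is w^-1 w' with w
   and w' seen as maps from TM to T^*M; the slot of a skew form into which the
   vector is inserted is immaterial here. *)
Definition form_quotient (w w' : tensor2) a p : 'M[R]_n :=
  invmx (w a p) *m w' a p.

Definition wedge (alpha beta : 'rV[R[i]]_n) : 'M[R[i]]_n :=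
  alpha^T *m beta - beta^T *m alpha.

Definition interior_product (X : 'cV[R[i]]_n) (w : 'M[R[i]]_n) : 'rV[R[i]]_n := X^T *m w.

End Manifold.

Record hyperkahler (R : realType) (m : nat) (M : smoothManifold R (4 * m)) :=
  Hyperkahler {
  omega1 : tensor2 M;
  omega2 : tensor2 M;
  omega3 : tensor2 M;
  metric : tensor2 M;
  omega1_symplectic : symplectic omega1;
  omega2_symplectic : symplectic omega2;
  omega3_symplectic : symplectic omega3;
  metric_riemannian : riemannian metric;
  quaternionic : forall a p, dom a p ->
    let I1 := form_quotient omega3 omega2 a p in
    let I2 := form_quotient omega1 omega3 a p in
    let I3 := form_quotient omega2 omega1 a p in
    [/\ I1 *m I1 = - 1%:M, I2 *m I2 = - 1%:M, I3 *m I3 = - 1%:M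
      & I1 *m I2 *m I3 = - 1%:M];
  metric_compatible : forall a p, dom a p ->
    [/\ omega1 a p = metric a p *m form_quotient omega3 omega2 a p,
        omega2 a p = metric a p *m form_quotient omega1 omega3 a p
      & omega3 a p = metric a p *m form_quotient omega2 omega1 a p]
}.

Section Hyperkahler.
Variables (R : realType) (m : nat) (M : smoothManifold R (4 * m)).
Variable H : hyperkahler M.
Implicit Types (a : chart_index M) (p : M) (f : M -> R[i]) (zeta : R[i]).
Implicit Types (U D : set M) (V : set (M * R[i])) (h : M -> R[i] -> R[i]).

Definition I1 a p := form_quotient (omega3 H) (omega2 H) a p.
Definition I2 a p := form_quotient (omega1 H) (omega3 H) a p.
Definition I3 a p := form_quotient (omega2 H) (omega1 H) a p.

Definition Iplus a p := 2^-1 *: (cmx (I1 a p) + 'i *: cmx (I2 a p)).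
Definition Izero a p := cmx (I3 a p).
Definition Iminus a p := - 2^-1 *: (cmx (I1 a p) - 'i *: cmx (I2 a p)).

Definition omega_plus a p :=
  2^-1 *: (cmx (omega1 H a p) + 'i *: cmx (omega2 H a p)).
Definition omega_zero a p := cmx (omega3 H a p).
Definition omega_minus a p :=
  - 2^-1 *: (cmx (omega1 H a p) - 'i *: cmx (omega2 H a p)).

Definition hyperpotential_chain D (f : int -> M -> R[i]) :=
  forall (n : int) a p, D p -> dom a p ->
    diff_in a (f (n - 1)) p *m Iplus a p + diff_in a (f n) p *m Izero a p
      + diff_in a (f (n + 1)) p *m Iminus a p = 0.

(* The twistor space M x S^2 away from the pole (0, 0, -1) of S^2 is described
   as M x C by means of the coordinate zeta; a function on it is a function
   [h : M -> R[i] -> R[i]] of (p, zeta). *)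
Definition sphere_coord (x1 x2 x3 : R) : R[i] :=
  - ((x1 +i* x2) / (1 + x3)%:C).

(* The CP^1 factor is multiplication by i, in the real basis d/d(Re zeta),
   d/d(Im zeta). *)
Definition twistor_structure a p (x1 x2 x3 : R) : 'M[R]_(4 * m + (1 + 1)) :=
  block_mx (x1 *: I1 a p + x2 *: I2 a p + x3 *: I3 a p) 0
           0 (block_mx 0 (- 1%:M) 1%:M 0).

Definition twistor_point (x : 'rV[R]_(4 * m)) zeta : 'rV[R]_(4 * m + (1 + 1)) :=
  row_mx x (row_mx (complex.Re zeta)%:M (complex.Im zeta)%:M).

Definition twistor_base (y : 'rV[R]_(4 * m + (1 + 1))) : 'rV[R]_(4 * m) :=
  lsubmx y.
Definition twistor_zeta (y : 'rV[R]_(4 * m + (1 + 1))) : R[i] :=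
  lsubmx (rsubmx y) 0 0 +i* rsubmx (rsubmx y) 0 0.

Definition twistor_in_chart a h : 'rV[R]_(4 * m + (1 + 1)) -> R[i] :=
  fun y => h (chart_inv a (twistor_base y)) (twistor_zeta y).

Definition twistor_d a h p zeta : 'rV[R[i]]_(4 * m + (1 + 1)) :=
  grad (twistor_in_chart a h) (twistor_point (chart a p) zeta).

Definition twistor_holomorphic V h :=
  (forall a, csmooth_on
     [set y | (chart a @` dom a) (twistor_base y) /\
              V (chart_inv a (twistor_base y), twistor_zeta y)]
     (twistor_in_chart a h)) /\
  (forall a p (x1 x2 x3 : R),
     x1 ^+ 2 + x2 ^+ 2 + x3 ^+ 2 = 1 -> x3 != - 1 ->
     let zeta := sphere_coord x1 x2 x3 in
     dom a p -> V (p, zeta) ->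
     twistor_d a h p zeta *m cmx (twistor_structure a p x1 x2 x3)
       = 'i *: twistor_d a h p zeta).

(* h(p, zeta) = c0(p) + c1(p) zeta + O(zeta^2) for each p in U. *)
Definition taylor1 U h (c0 c1 : M -> R[i]) := forall p, U p ->
  (fun zeta : (R[i])^o => h p zeta - (c0 p + c1 p * zeta) : (R[i])^o)
    =O_ (0 : (R[i])^o) (fun zeta : (R[i])^o => zeta ^+ 2 : (R[i])^o).

(* [eta A], [etat A] are the Darboux functions eta^A, \tilde eta_A on the open
   set [sc_V] of the twistor space, and [sz], [sv], [su], [sw] their Taylor
   coefficients z^A, v^A, u_A, w_A on U.  Only the part of the open set off
   zeta = oo matters, since the expansions are at zeta = 0. *)
Record special_functions U := SpecialFunctions {
  sc_V : set (M * R[i]);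
  eta : 'I_m -> M -> R[i] -> R[i];
  etat : 'I_m -> M -> R[i] -> R[i];
  sz : 'I_m -> M -> R[i];
  sv : 'I_m -> M -> R[i];
  su : 'I_m -> M -> R[i];
  sw : 'I_m -> M -> R[i];
  sc_V_open : open (sc_V : set (M * (R[i])^o));
  sc_U_open : open U;
  sc_U_sub : forall p, U p -> sc_V (p, 0);
  eta_holomorphic : forall A, twistor_holomorphic sc_V (eta A);
  etat_holomorphic : forall A, twistor_holomorphic sc_V (etat A);
  darboux : forall a p zeta, dom a p -> sc_V (p, zeta) ->
    \sum_A wedge (diff_in a (etat A ^~ zeta) p) (diff_in a (eta A ^~ zeta) p)
      = omega_plus a p + zeta *: omega_zero a p + zeta ^+ 2 *: omega_minus a p;
  eta_taylor : forall A, taylor1 U (eta A) (sz A) (sv A);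
  etat_taylor : forall A, taylor1 U (etat A) (su A) (sw A)
}.

(* Systems of 4m complex coordinate functions, in four groups of m functions;
   the index set 'I_4 x 'I_m is identified with 'I_(4 * m) by [mxvec_index].
   The rows of [coframe] are the differentials of the coordinates, and the
   coordinate vector fields are by definition the dual frame of the complexified
   tangent space (the Wirtinger vector fields when the coordinates come in
   conjugate pairs). *)
Section Coordinates.
Variable Y : 'M[M -> R[i]]_(4, m).

Definition coframe a p : 'M[R[i]]_(4 * m) :=
  \matrix_(r, j) diff_in a (mxvec Y 0 r) p 0 j.

Definition coordinate_system U :=
  [/\ forall b A, csmooth U (Y b A),
      forall a p, U p -> dom a p -> coframe a p \in unitmx
    & forall p q, U p -> U q -> (forall b A, Y b A p = Y b A q) -> p = q].

Definition coord_vf (b : 'I_4) (A : 'I_m) a p : 'cV[R[i]]_(4 * m) :=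
  col (mxvec_index b A) (invmx (coframe a p)).

Definition coord_pd (b : 'I_4) (A : 'I_m) a f p : R[i] :=
  (diff_in a f p *m coord_vf b A a p) 0 0.

End Coordinates.

Definition four_coords (y0 y1 y2 y3 : 'I_m -> M -> R[i]) :
    'M[M -> R[i]]_(4, m) :=
  \matrix_(b, A) tnth [tuple y0; y1; y2; y3] b A.

Definition grp0 : 'I_4 := inord 0.
Definition grp1 : 'I_4 := inord 1.
Definition grp2 : 'I_4 := inord 2.
Definition grp3 : 'I_4 := inord 3.

Section SpecialCoordinates.
Variables (U : set M) (S : special_functions U).

Definition szbar A : M -> R[i] := fun p => (sz S A p)^*.
Definition svbar A : M -> R[i] := fun p => (sv S A p)^*.

Definition coords1 := four_coords (sz S) (sv S) szbar svbar.
Local Notation v_ := grp1.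
Local Notation vbar_ := grp3.

Definition is_type1 :=
  (forall A, ~ (forall p, U p -> complex.Im (sv S A p) = 0)) /\
  coordinate_system coords1 U.

Definition rho a p : 'M[R[i]]_m :=
  \matrix_(A, B) (- 'i * coord_pd coords1 vbar_ B a (su S A) p).

Definition X1 a f p : 'cV[R[i]]_(4 * m) :=
  'i *: \sum_A \sum_B invmx (rho a p) A B *:
    (coord_pd coords1 vbar_ A a f p *: coord_vf coords1 v_ B a p
     - coord_pd coords1 v_ B a f p *: coord_vf coords1 vbar_ A a p).

Variable varrho : 'I_m -> M -> R.

Definition varrhoC A : M -> R[i] := fun p => (varrho A p)%:C.
Definition psit A : M -> R[i] :=
  fun p => (complex.Re (su S A p) - varrho A p)%:C.

Definition coords2 := four_coords (sz S) szbar (sv S) psit.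
Local Notation psi_ := grp2.
Local Notation psit_ := grp3.

Definition is_type2 :=
  [/\ forall A p, U p -> complex.Im (sv S A p) = 0,
      forall A p zeta, U p -> sc_V S (p, zeta) ->
        eta S A p zeta = sz S A p + sv S A p * zeta - (sz S A p)^* * zeta ^+ 2,
      coordinate_system coords2 U
    & [/\ forall A, csmooth U (varrhoC A),
          forall A B a p, U p -> dom a p ->
            coord_pd coords2 psit_ B a (varrhoC A) p = 0
        & forall A B a p, U p -> dom a p ->
            coord_pd coords2 psi_ B a (varrhoC A) p
            = coord_pd coords2 psi_ A a (varrhoC B) p]].

Definition X2 a f p : 'cV[R[i]]_(4 * m) :=
  \sum_A (coord_pd coords2 psi_ A a f p *: coord_vf coords2 psit_ A a p
          - coord_pd coords2 psit_ A a f p *: coord_vf coords2 psi_ A a p).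

End SpecialCoordinates.

Inductive special_coordinates U :=
  | Type1 (S : special_functions U) of is_type1 S
  | Type2 (S : special_functions U) (varrho : 'I_m -> M -> R)
      of is_type2 S varrho.

Definition special_gradient U (T : special_coordinates U) a f p :
    'cV[R[i]]_(4 * m) :=
  match T with
  | Type1 F _ => X1 F a f p
  | Type2 F varrho _ => X2 F varrho a f p
  end.

End Hyperkahler.

(* Main.v *)
Require Import Defs.
From mathcomp Require Import all_boot all_order all_algebra.
From mathcomp Require Import complex.
From mathcomp Require Import all_classical all_reals all_analysis.
From mathcomp Require Import ring.

Set Implicit Arguments.
Unset Strict Implicit.
Unset Printing Implicit Defensive.

Import Order.TTheory GRing.Theory Num.Theory numFieldNormedType.Exports.
Local Open Scope classical_set_scope.
Local Open Scope ring_scope.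
Local Open Scope complex_scope.

(** The statement is pointwise in the point p and the chart, and rests on
    linear algebra of the complexified tangent space.

    Write omega_+, omega_0, omega_- as the metric g composed with I_+, I_0,
    I_-.  The pencil I_+ + zeta I_0 + zeta^2 I_- squares to zero, coefficient
    by coefficient.  Hence the left side of the equation, for any sequence
    X_n of vectors whatsoever, is a chain ([nilpotent_pencil_chain]); this is
    the implication from the equation to the chain condition.

    For the converse let F be the common kernel of the dz^A and of their
    conjugates; it is spanned by the two coordinate fields that occur in X_f.
    In both types X_f is the gradient of f along F for omega_0, that is,
    X_f lies in F and its contraction with omega_0 agrees with df on F.  Since
    omega_+ = du_A /\ dz^A and omega_- is minus its conjugate, both vanish on
    F.  So the difference of df_n and the left side is a chain of covectors
    that vanish on F, and such a chain is zero ([chain_vanishing_on_leaf]):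
    because I_0 preserves F, the I_0-types separate in the chain condition and
    the covectors vanish on I_1 F as well; and F + I_1 F is the whole tangent
    space, since omega_1 vanishes on F and g is positive.

    That X_f is this gradient comes from omega_0 = du_A /\ dv^A on F
    ([omega_zero_darboux]), read in the coordinate frame: the reality of
    omega_0 (in type 2 with the symmetry of the psi-derivatives of varrho)
    kills the component along the d/dv (resp. d/dpsi), and the mixed component
    is i rho (resp. the identity).  The matrix rho is invertible as
    omega_0 is nondegenerate on the I_0-invariant subspace F.

    The analytic input is the comparison of the zeta-coefficients in the
    Darboux identity on the twistor space.  It needs that d along M commutes
    with the zeta-derivative at 0, that is, the symmetry of mixed second
    derivatives ([derive_comm]) of the smooth functions eta, \tilde eta. *)

(** * Matrices over the complex numbers *)

Section ComplexMatrices.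
Variable R : realType.

Definition conj_mx p q (A : 'M[R[i]]_(p, q)) : 'M[R[i]]_(p, q) :=
  map_mx (@conjc R) A.

Lemma conj_mxM p q r (A : 'M[R[i]]_(p, q)) (B : 'M[R[i]]_(q, r)) :
  conj_mx (A *m B) = conj_mx A *m conj_mx B.
Proof. exact: map_mxM. Qed.

Lemma conj_mxB p q (A B : 'M[R[i]]_(p, q)) :
  conj_mx (A - B) = conj_mx A - conj_mx B.
Proof. exact: map_mxB. Qed.

Lemma conj_mxT p q (A : 'M[R[i]]_(p, q)) : conj_mx A^T = (conj_mx A)^T.
Proof. by rewrite /conj_mx map_trmx. Qed.

Lemma conj_mx0 p q : conj_mx (0 : 'M[R[i]]_(p, q)) = 0.
Proof. exact: map_mx0. Qed.

Lemma conj_mx1 p : conj_mx (1%:M : 'M[R[i]]_p) = 1%:M.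
Proof. exact: map_mx1. Qed.

Lemma conj_mxK p q (A : 'M[R[i]]_(p, q)) : conj_mx (conj_mx A) = A.
Proof. by apply/matrixP => i j; rewrite !mxE conjcK. Qed.

Lemma conj_cmx p q (A : 'M[R]_(p, q)) : conj_mx (cmx A) = cmx A.
Proof. by apply/matrixP => i j; rewrite !mxE conjc_real. Qed.

Lemma cmxM p q r (A : 'M[R]_(p, q)) (B : 'M[R]_(q, r)) :
  cmx (A *m B) = cmx A *m cmx B.
Proof. exact: map_mxM. Qed.

Lemma cmxN p q (A : 'M[R]_(p, q)) : cmx (- A) = - cmx A.
Proof. exact: map_mxN. Qed.

Lemma cmx1 p : cmx (1%:M : 'M[R]_p) = 1%:M.
Proof. exact: map_mx1. Qed.

Lemma cmxT p q (A : 'M[R]_(p, q)) : cmx A^T = (cmx A)^T.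
Proof. by rewrite /cmx map_trmx. Qed.

Lemma complex_ii : 'i * 'i = -1 :> R[i].
Proof. by simpc. Qed.

(** The reason why omega_- is minus the conjugate of omega_+. *)
Lemma conj_ladder p q (A B : 'M[R]_(p, q)) :
  conj_mx (2^-1 *: (cmx A + 'i *: cmx B)) = 2^-1 *: (cmx A - 'i *: cmx B).
Proof.
have halfE : 2^-1 = (2^-1 : R)%:C :> R[i] by rewrite fmorphV rmorph_nat.
apply/matrixP => r s; rewrite !mxE halfE; move: (A r s) (B r s) => x y.
by simpc.
Qed.

(** With X = a + ib the symmetric cross terms cancel, and what remains is
    g(a, a) + g(b, b). *)
Lemma sesquilinear_posdef n (g : 'M[R]_n) :
  g^T = g -> (forall X : 'cV[R]_n, X != 0 -> 0 < (X^T *m g *m X) 0 0) ->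
  forall X : 'cV[R[i]]_n, (conj_mx X)^T *m cmx g *m X = 0 -> X = 0.
Proof.
move=> gT gpos X.
pose a := map_mx (@complex.Re R) X; pose b := map_mx (@complex.Im R) X.
have XE : X = cmx a + 'i *: cmx b.
  by apply/matrixP => i j; rewrite !mxE; case: (X i j) => x y; simpc.
have XbE : conj_mx X = cmx a - 'i *: cmx b.
  by apply/matrixP => i j; rewrite !mxE; case: (X i j) => x y; simpc.
have sym : b^T *m g *m a = a^T *m g *m b.
  have -> : b^T *m g *m a = (a^T *m g *m b)^T.
    by rewrite !trmx_mul trmxK gT mulmxA.
  by apply/matrixP=> i j; rewrite !ord1 [LHS]mxE.
have expand : (conj_mx X)^T *m cmx g *m X
    = cmx (a^T *m g *m a + b^T *m g *m b).
  rewrite XbE {1}XE linearB /= linearZ /= mulmxDr !mulmxBl -!scalemxAl -!scalemxAr.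
  rewrite -!cmxT -!cmxM sym.
  rewrite [cmx (_ + _)]map_mxD scalerA complex_ii scaleN1r opprK.
  by rewrite addrA subrK.
rewrite expand => /matrixP/(_ 0 0).
rewrite [cmx _ _ _]mxE [RHS]mxE [X in X%:C = _]mxE => -[] /eqP.
have nonneg (c : 'cV[R]_n) : 0 <= (c^T *m g *m c) 0 0.
  by have [->|/gpos/ltW//] := eqVneq c 0; rewrite mulmx0 mxE.
have zero (c : 'cV[R]_n) : (c^T *m g *m c) 0 0 = 0 -> c = 0.
  by have [//|/gpos/gt_eqF/eqP] := eqVneq c 0.
rewrite paddr_eq0 // => /andP[/eqP/zero a0 /eqP/zero b0].
by rewrite XE a0 b0; apply/matrixP => i j; rewrite !mxE; simpc.
Qed.
End ComplexMatrices.

(** Rows of A and B are one-forms, columns of Q and S are vectors: this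
    evaluates the two-form sum_A A_A /\ B_A on the vectors. *)
Lemma skew_pullback (F : fieldType) m n k l (A B : 'M[F]_(m, n))
    (Q : 'M[F]_(n, k)) (S : 'M[F]_(n, l)) :
  Q^T *m (A^T *m B - B^T *m A) *m S
  = (A *m Q)^T *m (B *m S) - (B *m Q)^T *m (A *m S).
Proof. by rewrite mulmxBr mulmxBl !trmx_mul !mulmxA. Qed.

Lemma skew_pullback_kernel (F : fieldType) m n k l (A B W Z : 'M[F]_(m, n))
    (Q : 'M[F]_(n, k)) (S : 'M[F]_(n, l)) : Z *m Q = 0 -> Z *m S = 0 ->
  Q^T *m (A^T *m B - B^T *m A + (W^T *m Z - Z^T *m W)) *m S
  = (A *m Q)^T *m (B *m S) - (B *m Q)^T *m (A *m S).
Proof.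
move=> ZQ ZS; rewrite mulmxDr mulmxDl !skew_pullback ZQ ZS mulmx0 trmx0 mul0mx.
by rewrite subrr addr0.
Qed.

Lemma mulmx_col_combination (F : fieldType) m n (e : 'M[F]_(n, m))
    (c : 'cV[F]_m) :
  e *m c = \sum_B c B 0 *: col B e.
Proof.
apply/colP => j; rewrite mxE summxE; apply: eq_bigr => B _.
by rewrite !mxE mulrC.
Qed.

(** Brings the indexed bivector formulas for the gradients X_f to matrix
    form. *)
Lemma bivector_contraction (F : fieldType) m n (e1 e2 : 'M[F]_(n, m))
    (r : 'M[F]_m) (x y : 'rV[F]_m) :
  \sum_A \sum_B r A B *: (y 0 A *: col B e1 - x 0 B *: col A e2)
  = e1 *m (r^T *m y^T) - e2 *m (r *m x^T).
Proof.
rewrite (mulmx_col_combination e1) (mulmx_col_combination e2).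
under [X in _ = X - _]eq_bigr do rewrite mxE scaler_suml.
rewrite [X in _ = X - _]exchange_big -sumrB; apply: eq_bigr => A _ /=.
rewrite [(r *m x^T) A 0]mxE scaler_suml -sumrB; apply: eq_bigr => B _.
by rewrite !mxE scalerBr !scalerA.
Qed.

(** * Quaternionic structures and their chains *)

Section Quaternions.
Variables (F : fieldType) (n : nat) (J1 J2 J3 : 'M[F]_n) (i : F).
Hypothesis J1J1 : J1 *m J1 = - 1%:M.
Hypothesis J2J2 : J2 *m J2 = - 1%:M.
Hypothesis J3J3 : J3 *m J3 = - 1%:M.
Hypothesis J1J2J3 : J1 *m J2 *m J3 = - 1%:M.
Hypothesis ii : i * i = -1.
Hypothesis two_neq0 : 2 != 0 :> F.

Lemma quat12 : J1 *m J2 = J3.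
Proof.
apply: oppr_inj; rewrite -[J1 *m J2]mulmx1 -mulmxN -J3J3 mulmxA J1J2J3.
by rewrite mulNmx mul1mx.
Qed.

Lemma quat23 : J2 *m J3 = J1.
Proof.
apply: oppr_inj; rewrite -[J2 *m J3]mul1mx -mulNmx -J1J1 -!mulmxA.
by rewrite [J1 *m (J2 *m J3)]mulmxA J1J2J3 mulmxN mulmx1.
Qed.

Lemma quat13 : J1 *m J3 = - J2.
Proof. by rewrite -quat12 mulmxA J1J1 mulNmx mul1mx. Qed.

Lemma quat32 : J3 *m J2 = - J1.
Proof. by rewrite -quat12 -mulmxA J2J2 mulmxN mulmx1. Qed.

Lemma quat21 : J2 *m J1 = - J3.
Proof. by rewrite -quat23 mulmxA J2J2 mulNmx mul1mx. Qed.

Lemma quat31 : J3 *m J1 = J2.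
Proof.
by apply: oppr_inj; rewrite -quat12 -mulmxA quat21 mulmxN quat13 opprK.
Qed.

(** The quaternion product; the relations among the ladder operators below
    are instances of it. *)
Lemma quat_mul (x1 x2 x3 y1 y2 y3 : F) :
  (x1 *: J1 + x2 *: J2 + x3 *: J3) *m (y1 *: J1 + y2 *: J2 + y3 *: J3) =
  (- (x1 * y1 + x2 * y2 + x3 * y3)) *: 1%:M
  + (x2 * y3 - x3 * y2) *: J1 + (x3 * y1 - x1 * y3) *: J2
  + (x1 * y2 - x2 * y1) *: J3.
Proof.
rewrite !mulmxDl !mulmxDr -!scalemxAl -!scalemxAr.
rewrite J1J1 J2J2 J3J3 quat12 quat13 quat21 quat23 quat31 quat32.
move: (1%:M : 'M[F]_n) => E.
apply/matrixP => k l; rewrite !mxE.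
move: (E k l) (J1 k l) (J2 k l) (J3 k l) => e a b c; ring.
Qed.

Definition ladder_up : 'M[F]_n := 2^-1 *: (J1 + i *: J2).
Definition ladder_down : 'M[F]_n := - 2^-1 *: (J1 - i *: J2).

Let upE : ladder_up = 2^-1 *: J1 + (i / 2) *: J2 + 0 *: J3.
Proof. by rewrite scale0r addr0 /ladder_up scalerDr scalerA [_^-1 * _]mulrC. Qed.

Let downE : ladder_down = - 2^-1 *: J1 + (i / 2) *: J2 + 0 *: J3.
Proof. by apply/matrixP => k l; rewrite !mxE; ring. Qed.

Let J3E : J3 = 0 *: J1 + 0 *: J2 + 1 *: J3.
Proof. by rewrite !scale0r !add0r scale1r. Qed.

(** Both sides are combinations of 1, J1, J2, J3, so generic entries of these
    four matrices reduce the goal to an identity in the field. *)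
Ltac quat_field :=
  let E := fresh "E" in let k := fresh "k" in let l := fresh "l" in
  move: (1%:M : 'M[F]_n) => E; apply/matrixP => k l; rewrite !mxE;
  move: (E k l) (J1 k l) (J2 k l) (J3 k l) => ? ? ? ?;
  field: ii; exact: two_neq0.

Lemma up_up : ladder_up *m ladder_up = 0.
Proof. rewrite upE quat_mul; quat_field. Qed.

Lemma up_J3 : ladder_up *m J3 = i *: ladder_up.
Proof. rewrite upE [X in _ *m X]J3E quat_mul; quat_field. Qed.

Lemma J3_up : J3 *m ladder_up = - i *: ladder_up.
Proof. rewrite upE [X in X *m _]J3E quat_mul; quat_field. Qed.

Lemma down_down : ladder_down *m ladder_down = 0.
Proof. rewrite downE quat_mul; quat_field. Qed.

Lemma down_J3 : ladder_down *m J3 = - i *: ladder_down.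
Proof. rewrite downE [X in _ *m X]J3E quat_mul; quat_field. Qed.

Lemma J3_down : J3 *m ladder_down = i *: ladder_down.
Proof. rewrite downE [X in X *m _]J3E quat_mul; quat_field. Qed.

Lemma up_down : ladder_up *m ladder_down + ladder_down *m ladder_up = 1%:M.
Proof. rewrite upE downE !quat_mul; quat_field. Qed.
End Quaternions.

(** The coefficientwise form of d(zeta) (P + zeta Z + zeta^2 N) = 0 for the
    two-sided series d(zeta) = sum_k d_k zeta^(-k); for the ladder pencil of
    a complex structure this is the chain condition on df_k. *)
Definition pencil_chain (F : fieldType) n (P Z N : 'M[F]_n)
    (d : int -> 'rV[F]_n) :=
  forall k : int, d (k - 1) *m P + d k *m Z + d (k + 1) *m N = 0.

(** The hypotheses say that the square of P + zeta Z + zeta^2 N vanishes, and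
    the sequence is the product of y with this pencil. *)
Lemma nilpotent_pencil_chain (F : fieldType) n (P Z N : 'M[F]_n)
    (y : int -> 'rV[F]_n) :
  P *m P = 0 -> P *m Z + Z *m P = 0 -> P *m N + Z *m Z + N *m P = 0 ->
  Z *m N + N *m Z = 0 -> N *m N = 0 ->
  pencil_chain P Z N (fun k => y (k - 1) *m P + y k *m Z + y (k + 1) *m N).
Proof.
move=> PP PZ PZN ZN NN k.
have [-> ->] : k - 1 + 1 = k /\ k + 1 - 1 = k by rewrite subrK addrK.
move: (y (k - 1 - 1)) (y (k - 1)) (y k) (y (k + 1)) (y (k + 1 + 1)).
move=> c1 c2 c3 c4 c5; rewrite !mulmxDl -!mulmxA PP NN !mulmx0.
transitivity (c2 *m (P *m Z + Z *m P) + c3 *m (P *m N + Z *m Z + N *m P)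
              + c4 *m (Z *m N + N *m Z)).
  rewrite !mulmxDr; apply/matrixP => r s; rewrite !mxE; ring.
by rewrite PZ PZN ZN !mulmx0 !addr0.
Qed.

Lemma pencil_chainB (F : fieldType) n (P Z N : 'M[F]_n)
    (d s : int -> 'rV[F]_n) :
  pencil_chain P Z N d -> pencil_chain P Z N s ->
  pencil_chain P Z N (fun k => d k - s k).
Proof.
move=> dch sch k; have:= dch k; have := sch k.
move: (k - 1) (k + 1) => k1 k2 sk dk; rewrite -[RHS](subrr 0) -{1}dk -sk.
rewrite !mulmxBl; apply/matrixP => i j; rewrite !mxE; ring.
Qed.

(** * The leaf of the holomorphic functions z *)

(** The columns of Q form a basis of F, the common kernel of dz and its
    conjugate, and L reads off coordinates in this basis; k is the dimension
    of F, half that of the whole space. *)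
Section Leaf.
Variables (R : realType) (n : nat) (G Jp J0 Jm : 'M[R[i]]_n).
Hypothesis G_sym : G^T = G.
Hypothesis G_posdef :
  forall X : 'cV[R[i]]_n, (conj_mx X)^T *m G *m X = 0 -> X = 0.
Hypothesis J0_real : conj_mx J0 = J0.
Hypothesis J0J0 : J0 *m J0 = - 1%:M.
Hypothesis JpJ0 : Jp *m J0 = 'i *: Jp.
Hypothesis JmJ0 : Jm *m J0 = - 'i *: Jm.
Hypothesis J0Jp : J0 *m Jp = - 'i *: Jp.
Hypothesis J0Jm : J0 *m Jm = 'i *: Jm.
Hypothesis JpJp : Jp *m Jp = 0.
Hypothesis JmJm : Jm *m Jm = 0.
Hypothesis Jp_Jm : Jp *m Jm + Jm *m Jp = 1%:M.
Hypothesis omega_minusE : G *m Jm = - conj_mx (G *m Jp).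

Let two0 : 2 != 0 :> R[i]. Proof. by rewrite pnatr_eq0. Qed.

Variables (m k : nat) (dz du : 'M[R[i]]_(m, n)).
Variables (Q : 'M[R[i]]_(n, k)) (L : 'M[R[i]]_(k, n)).
Hypothesis omega_plusE : G *m Jp = du^T *m dz - dz^T *m du.
Hypothesis dz_holo : dz *m J0 = 'i *: dz.
Hypothesis dzQ : dz *m Q = 0.
Hypothesis dzbarQ : conj_mx dz *m Q = 0.
Hypothesis QL : forall r (X : 'M[R[i]]_(n, r)),
  dz *m X = 0 -> conj_mx dz *m X = 0 -> X = Q *m (L *m X).
Hypothesis LQ : L *m Q = 1%:M.

(** F is stable under conjugation because its two families of equations are
    exchanged. *)
Lemma leaf_conj r (x : 'M[R[i]]_(k, r)) :
  conj_mx (Q *m x) = Q *m (L *m conj_mx (Q *m x)).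
Proof.
apply: QL.
  by rewrite -[dz]conj_mxK -conj_mxM mulmxA dzbarQ mul0mx conj_mx0.
by rewrite -conj_mxM mulmxA dzQ mul0mx conj_mx0.
Qed.

Lemma dzbar_holo : conj_mx dz *m J0 = - 'i *: conj_mx dz.
Proof.
rewrite -J0_real -conj_mxM dz_holo.
by apply/matrixP => r s; rewrite !mxE rmorphM /=; congr (_ * _); simpc.
Qed.

(** The equations of F are eigenforms of I_0. *)
Lemma leaf_invariant : J0 *m Q = Q *m (L *m (J0 *m Q)).
Proof.
apply: QL; rewrite mulmxA ?dz_holo ?dzbar_holo -scalemxAl.
  by rewrite dzQ scaler0.
by rewrite dzbarQ scaler0.
Qed.

Lemma omega_plus_leaf : Q^T *m (G *m Jp) *m Q = 0.
Proof.
by rewrite omega_plusE skew_pullback dzQ mulmx0 trmx0 mul0mx subrr.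
Qed.

Lemma omega_minus_leaf : Q^T *m (G *m Jm) *m Q = 0.
Proof.
rewrite omega_minusE omega_plusE conj_mxB !conj_mxM !conj_mxT mulmxN mulNmx.
by rewrite skew_pullback dzbarQ mulmx0 trmx0 mul0mx subrr oppr0.
Qed.

(* I_+ - I_- is I_1. *)
Let K : 'M[R[i]]_n := Jp - Jm.

Lemma ladder_diffK : K *m K = - 1%:M.
Proof.
by rewrite /K mulmxBl !mulmxBr JpJp JmJm sub0r subr0 -opprD Jp_Jm.
Qed.

Lemma leaf_posdef (x : 'cV[R[i]]_k) :
  (conj_mx (Q *m x))^T *m G *m (Q *m x) = 0 -> x = 0.
Proof.
move/G_posdef => Qx0.
by rewrite -[x]mul1mx -LQ -mulmxA Qx0 mulmx0.
Qed.

(** If X in F pairs to zero with F under omega_0, pair it with I_0 of its own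
    conjugate, which lies in F: the value is minus the Hermitian norm of X. *)
Lemma omega_zero_leaf_nondegenerate (x : 'cV[R[i]]_k) :
  (Q *m x)^T *m (G *m J0) *m Q = 0 -> x = 0.
Proof.
move=> x0; apply: leaf_posdef.
pose z := L *m (J0 *m Q) *m (L *m conj_mx (Q *m x)).
have conjE : conj_mx (Q *m x) = - (J0 *m (Q *m z)).
  have <- : J0 *m conj_mx (Q *m x) = Q *m z.
    by rewrite {1}leaf_conj mulmxA leaf_invariant /z !mulmxA.
  by rewrite mulmxA J0J0 mulNmx mul1mx opprK.
apply: (can_inj (@trmxK _ _ _)); rewrite trmx0 trmx_mul [X in _ *m X]trmx_mul.
rewrite trmxK G_sym conjE !mulmxN !mulmxA.
by rewrite mulmxA in x0; rewrite x0 !mul0mx oppr0.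
Qed.

Hypothesis kkn : (k + k = n)%N.

(** F and I_1 F are orthogonal for the Hermitian metric, as omega_1 vanishes
    on F, and each has half the dimension, so they span. *)
Lemma leaf_span (e : 'rV[R[i]]_n) :
  e *m Q = 0 -> e *m K *m Q = 0 -> e = 0.
Proof.
move=> eQ eJQ; pose B := row_mx Q (K *m Q).
suff freeB : row_free B.
  apply/eqP; rewrite -(mulmx_free_eq0 _ freeB) mul_mx_row mulmxA eQ eJQ.
  by rewrite row_mx0.
suff: row_free B^T.
  by rewrite /row_free mxrank_tr => /eqP rB; apply/eqP; exact: etrans rB kkn.
apply: inj_row_free => v /(congr1 trmx); rewrite trmx_mul trmxK trmx0.
rewrite -[v]hsubmxK; move: (lsubmx v) (rsubmx v) => a b.
rewrite tr_row_mx mul_row_col => sum0.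
have QaE : Q *m a^T = - (K *m (Q *m b^T)).
  by apply/eqP; rewrite -addr_eq0 mulmxA sum0.
have a0 : a^T = 0.
  have QGKQ : Q^T *m (G *m K) *m Q = 0.
    by rewrite /K 2!mulmxBr mulmxBl omega_plus_leaf omega_minus_leaf subrr.
  apply: leaf_posdef; rewrite leaf_conj QaE mulmxN.
  have -> (c : 'cV_k) : (Q *m c)^T *m G *m (K *m (Q *m b^T))
      = c^T *m (Q^T *m (G *m K) *m Q) *m b^T by rewrite trmx_mul !mulmxA.
  by rewrite QGKQ mulmx0 mul0mx oppr0.
have b0 : b^T = 0.
  have Qb0 : Q *m b^T = 0.
    rewrite -[Q *m _]opprK -[in LHS](mul1mx (Q *m b^T)) -mulNmx -ladder_diffK -mulmxA.
    by rewrite -[K *m (Q *m _)]opprK -QaE a0 mulmx0 oppr0 mulmx0 oppr0.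
  by rewrite -[b^T]mul1mx -LQ -mulmxA Qb0 mulmx0.
by rewrite -[a]trmxK -[b]trmxK a0 b0 !trmx0 row_mx0.
Qed.

(** On F the middle term of the chain condition drops out, leaving the sum of
    e_(l-1) I_+ and e_(l+1) I_-.  These have opposite eigenvalues under I_0,
    which preserves F, so each vanishes on F; subtracting, every e_l also
    vanishes on I_1 F. *)
Lemma chain_vanishing_on_leaf (e : int -> 'rV[R[i]]_n) :
  pencil_chain Jp J0 Jm e -> (forall l, e l *m Q = 0) -> forall l, e l = 0.
Proof.
move=> ch eQ.
have leafZ (c : 'rV[R[i]]_n) (P : 'M[R[i]]_n) mu : P *m J0 = mu *: P ->
    c *m P *m Q *m (L *m (J0 *m Q)) = mu *: (c *m P *m Q).
  move=> PJ0; rewrite -(mulmxA _ Q) -leaf_invariant mulmxA -(mulmxA c) PJ0.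
  by rewrite -scalemxAr -scalemxAl.
have split l : e (l - 1) *m Jp *m Q = 0 /\ e (l + 1) *m Jm *m Q = 0.
  have sum0 : e (l - 1) *m Jp *m Q + e (l + 1) *m Jm *m Q = 0.
    have := congr1 (mulmx^~ Q) (ch l); rewrite !mulmxDl mul0mx.
    by rewrite -(mulmxA (e l)) leaf_invariant mulmxA eQ mul0mx addr0.
  have dif0 : e (l - 1) *m Jp *m Q - e (l + 1) *m Jm *m Q = 0.
    have i0 : 'i != 0 :> R[i] by rewrite eq_complex /= oner_eq0 andbF.
    apply: (scalerI i0); rewrite scaler0.
    have := congr1 (mulmx^~ (L *m (J0 *m Q))) sum0.
    rewrite /= mulmxDl mul0mx (leafZ _ _ _ JpJ0) (leafZ _ _ _ JmJ0).
    by rewrite scaleNr -scalerBr.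
  have two_a : e (l - 1) *m Jp *m Q *+ 2 = 0.
    by rewrite mulr2n -[X in X + _](subrK (e (l + 1) *m Jm *m Q)) dif0 add0r addrC.
  have a0 : e (l - 1) *m Jp *m Q = 0.
    by apply: (scalerI two0); rewrite scaler0 scaler_nat.
  by split=> //; move: sum0; rewrite a0 add0r.
move=> l; apply: leaf_span => //.
have [+ _] := split (l + 1); have [_ +] := split (l - 1).
have [-> ->] : l - 1 + 1 = l /\ l + 1 - 1 = l by rewrite subrK addrK.
by rewrite /K mulmxBr mulmxBl => -> ->; rewrite subrr.
Qed.

(** One direction holds for every sequence X; the other uses that d minus the
    right side is a chain and vanishes on F, where omega_+ and omega_- are
    zero. *)
Lemma leaf_gradient_chainP (d : int -> 'rV[R[i]]_n) (X : int -> 'cV[R[i]]_n)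
    (x : int -> 'cV[R[i]]_k) :
  (forall l, X l = Q *m x l) ->
  (forall l, (X l)^T *m (G *m J0) *m Q = d l *m Q) ->
  pencil_chain Jp J0 Jm d <->
  (forall l, (X (l - 1))^T *m (G *m Jp) + (X l)^T *m (G *m J0)
             + (X (l + 1))^T *m (G *m Jm) = d l).
Proof.
move=> XE Xd.
pose s l := (X (l - 1))^T *m (G *m Jp) + (X l)^T *m (G *m J0)
             + (X (l + 1))^T *m (G *m Jm).
have s_chain : pencil_chain Jp J0 Jm s.
  have [c1 c2] : Jp *m J0 + J0 *m Jp = 0 /\ J0 *m Jm + Jm *m J0 = 0.
    by rewrite JpJ0 J0Jp J0Jm JmJ0 !scaleNr !subrr.
  have c3 : Jp *m Jm + J0 *m J0 + Jm *m Jp = 0.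
    by rewrite J0J0 addrAC Jp_Jm subrr.
  have := nilpotent_pencil_chain (fun l => (X l)^T *m G) JpJp c1 c3 c2 JmJm.
  by move=> + l => /(_ l); rewrite /s !mulmxA.
split=> [d_chain l|sd l]; last by rewrite -!sd; exact: s_chain.
apply/eqP; rewrite eq_sym -subr_eq0; apply/eqP.
apply: (@chain_vanishing_on_leaf (fun l => d l - s l)) => [|j].
  exact: pencil_chainB.
have leafE i (P : 'M[R[i]]_n) :
    (X i)^T *m P *m Q = (x i)^T *m (Q^T *m P *m Q).
  by rewrite XE trmx_mul !mulmxA.
rewrite mulmxBl -Xd /s !mulmxDl (leafE (j - 1)) (leafE (j + 1)).
by rewrite omega_plus_leaf omega_minus_leaf !mulmx0 add0r addr0 subrr.
Qed.

End Leaf.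

(** * Symmetry of second derivatives *)

Section SymmetryOfSecondDerivatives.
Variables (R : realType) (V : normedModType R).
Implicit Types (f : V -> R) (x u v : V).

Lemma is_derive_line f x u (s : R) :
  derivable f (x + s *: u) u ->
  is_derive s 1 (fun t : R => f (x + t *: u)) ('D_u f (x + s *: u)).
Proof.
have quotE : (fun h : R => h^-1 *:
      (((fun t : R => f (x + t *: u)) \o shift s) (h *: (1 : R)) - f (x + s *: u)))
    = (fun h : R => h^-1 *: ((f \o shift (x + s *: u)) (h *: u) - f (x + s *: u))).
  apply/funext => h /=; congr (_ *: (f _ - _)).
  by rewrite scaler1 scalerDl addrCA.
by move=> fu; split; [rewrite /derivable quotE|rewrite /derive quotE].
Qed.

(** The mean value theorem in the direction u, applied to the increment of f
    by r v, and then in the direction v. *)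
Lemma second_difference f x u v (r : R) : 0 < r ->
  (forall s t, 0 <= s <= r -> 0 <= t <= r ->
     derivable f (x + s *: u + t *: v) u /\
     derivable ('D_u f) (x + s *: u + t *: v) v) ->
  exists s t, [/\ 0 <= s <= r, 0 <= t <= r &
    f (x + r *: u + r *: v) - f (x + r *: u) - (f (x + r *: v) - f x)
    = 'D_v ('D_u f) (x + s *: u + t *: v) * r * r].
Proof.
move=> r0 df.
have r0r : 0 <= r <= r by rewrite lexx ltW.
have z0r : 0 <= (0 : R) <= r by rewrite lexx ltW.
pose phi s : R := f (x + r *: v + s *: u) - f (x + s *: u).
pose dphi s : R := 'D_u f (x + r *: v + s *: u) - 'D_u f (x + s *: u).
have phi' s : 0 <= s <= r -> is_derive s (1 : R) phi (dphi s).
  move=> sr; apply: is_deriveB; apply: is_derive_line.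
    by rewrite addrAC; apply: (df s r sr r0r).1.
  by have := (df s 0 sr z0r).1; rewrite scale0r addr0.
have in0r (s : R) : s \in `[0, r]%R -> 0 <= s <= r by rewrite in_itv.
have oc0r (s : R) : s \in `]0, r[%R -> 0 <= s <= r.
  by rewrite in_itv => /andP[/ltW-> /ltW->].
have cphi : {within `[0, r], continuous phi}.
  by apply: derivable_within_continuous => s /in0r /phi' [].
have [s /oc0r sr phiE] := MVT r0 (fun s sr => phi' s (oc0r s sr)) cphi.
pose psi t : R := 'D_u f (x + s *: u + t *: v).
have psi' t : 0 <= t <= r ->
    is_derive t (1 : R) psi ('D_v ('D_u f) (x + s *: u + t *: v)).
  by move=> tr; apply: is_derive_line; apply: (df s t sr tr).2.
have cpsi : {within `[0, r], continuous psi}.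
  by apply: derivable_within_continuous => t /in0r /psi' [].
have [t /oc0r tr psiE] := MVT r0 (fun t tr => psi' t (oc0r t tr)) cpsi.
exists s, t; split => //; rewrite -[r in _ * r](subr0 r).
move: phiE psiE; rewrite /phi /dphi /psi !scale0r !addr0 (addrAC x (r *: v)).
by rewrite (addrAC x (r *: v)) !subr0 => -> ->.
Qed.

(** Both iterated derivatives, at two points within r of x, equal the second
    difference quotient of step r; continuity at x finishes. *)
Lemma derive_comm f x u v :
  (\forall y \near x, [/\ derivable f y u, derivable f y v,
     derivable ('D_u f) y v & derivable ('D_v f) y u]) ->
  {for x, continuous ('D_v ('D_u f))} -> {for x, continuous ('D_u ('D_v f))} ->
  'D_v ('D_u f) x = 'D_u ('D_v f) x.
Proof.
move=> df cvu cuv; apply/eqP; rewrite -subr_eq0 -normr_le0 leNgt.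
apply/negP => gap.
set e := `| _ - _ | in gap; have e2 : 0 < e / 2 by rewrite divr_gt0.
have /cvgrPdist_lt/(_ _ e2) near_vu := cvu.
have /cvgrPdist_lt/(_ _ e2) near_uv := cuv.
have : nbhs x (fun y => [/\ derivable f y u, derivable f y v,
    derivable ('D_u f) y v & derivable ('D_v f) y u] /\
    (`|'D_v ('D_u f) x - 'D_v ('D_u f) y| < e / 2 /\
     `|'D_u ('D_v f) x - 'D_u ('D_v f) y| < e / 2)).
  exact: filterI df (filterI near_vu near_uv).
rewrite -nbhs_ballE => -[d /= d0 ballP].
pose N := `|u| + `|v| + 1; have N0 : 0 < N by rewrite ltr_wpDl// addr_ge0.
pose r := d / N; have r0 : 0 < r by rewrite divr_gt0.
have near_x s t : 0 <= s <= r -> 0 <= t <= r -> ball x d (x + s *: u + t *: v).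
  move=> /andP[s0 sr] /andP[t0 tr]; rewrite -ball_normE /ball_ /=.
  rewrite -addrA opprD addNKr normrN.
  apply: (le_lt_trans (ler_normD _ _)); rewrite !normrZ !ger0_norm//.
  apply: (@le_lt_trans _ _ (r * (`|u| + `|v|))).
    by rewrite mulrDr lerD// ler_wpM2r.
  have -> : d = r * N by rewrite /r divfK// gt_eqF.
  by rewrite ltr_pM2l// /N ltrDl.
have near_x' t s : 0 <= t <= r -> 0 <= s <= r -> ball x d (x + t *: v + s *: u).
  by move=> tr sr; rewrite addrAC; exact: near_x.
have dfu s t : 0 <= s <= r -> 0 <= t <= r ->
    derivable f (x + s *: u + t *: v) u /\
    derivable ('D_u f) (x + s *: u + t *: v) v.
  by move=> sr tr; have [[]] := ballP _ (near_x s t sr tr).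
have dfv t s : 0 <= t <= r -> 0 <= s <= r ->
    derivable f (x + t *: v + s *: u) v /\
    derivable ('D_v f) (x + t *: v + s *: u) u.
  by move=> tr sr; have [[]] := ballP _ (near_x' t s tr sr).
have [s [t [sr tr E1]]] := second_difference r0 dfu.
have [t' [s' [tr' sr' E2]]] := second_difference r0 dfv.
have [_ [b1 _]] := ballP _ (near_x s t sr tr).
have [_ [_ b2]] := ballP _ (near_x' t' s' tr' sr').
have : 'D_v ('D_u f) (x + s *: u + t *: v) = 'D_u ('D_v f) (x + t' *: v + s' *: u).
  have rr : r != 0 by rewrite gt_eqF.
  apply: (mulIf rr); apply: (mulIf rr); apply: etrans (esym E1) (etrans _ E2).
  rewrite (addrAC x (r *: v) (r *: u)).
  move: (f (x + r *: u + r *: v)) (f (x + r *: u)) (f (x + r *: v)) (f x).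
  by move=> f11 f10 f01 f00; ring.
move=> E; move: b1 b2; rewrite /= E => b1 b2.
have : e < e; last by rewrite ltxx.
rewrite {2}(splitr e); apply: le_lt_trans (ltrD b1 b2).
rewrite [X in _ <= _ + X]distrC; apply: le_trans (ler_normD _ _).
by rewrite /e addrA subrK.
Qed.

End SymmetryOfSecondDerivatives.

(** * Derivatives at zero of complex curves *)

Section ComplexCurves.
Variable R : realType.
Implicit Types (F G : R -> R[i]) (d e : R[i]).

Definition derives0 F d :=
  is_derive (0 : R) (1 : R) (fun t => complex.Re (F t)) (complex.Re d) /\
  is_derive (0 : R) (1 : R) (fun t => complex.Im (F t)) (complex.Im d).

Lemma derives0_cst c : derives0 (fun=> c) 0.
Proof. by split; exact: is_derive_cst. Qed.

Lemma derives0_real : derives0 (fun t => t%:C) 1.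
Proof. by split; [exact: is_derive_id|exact: is_derive_cst]. Qed.

Lemma derives0D F G d e :
  derives0 F d -> derives0 G e -> derives0 (fun t => F t + G t) (d + e).
Proof.
move=> [Fr Fi] [Gr Gi]; split.
  have -> : (fun t => complex.Re (F t + G t))
      = (fun t => complex.Re (F t)) + (fun t => complex.Re (G t)).
    by apply/funext => t /=; rewrite raddfD.
  by rewrite raddfD; exact: is_deriveD.
have -> : (fun t => complex.Im (F t + G t))
    = (fun t => complex.Im (F t)) + (fun t => complex.Im (G t)).
  by apply/funext => t /=; rewrite raddfD.
by rewrite raddfD; exact: is_deriveD.
Qed.

Lemma derives0B F G d e :
  derives0 F d -> derives0 G e -> derives0 (fun t => F t - G t) (d - e).
Proof.
move=> [Fr Fi] [Gr Gi]; split.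
  have -> : (fun t => complex.Re (F t - G t))
      = (fun t => complex.Re (F t)) - (fun t => complex.Re (G t)).
    by apply/funext => t /=; rewrite raddfB.
  by rewrite raddfB; exact: is_deriveB.
have -> : (fun t => complex.Im (F t - G t))
    = (fun t => complex.Im (F t)) - (fun t => complex.Im (G t)).
  by apply/funext => t /=; rewrite raddfB.
by rewrite raddfB; exact: is_deriveB.
Qed.

Lemma derives0M F G d e : derives0 F d -> derives0 G e ->
  derives0 (fun t => F t * G t) (d * G 0 + F 0 * e).
Proof.
move=> [Fr Fi] [Gr Gi].
have ReM (x y : R[i]) : complex.Re (x * y) =
    complex.Re x * complex.Re y - complex.Im x * complex.Im y.
  by case: x => a b; case: y => a' b'; simpc.
have ImM (x y : R[i]) : complex.Im (x * y) =
    complex.Re x * complex.Im y + complex.Im x * complex.Re y.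
  by case: x => a b; case: y => a' b'; simpc.
have ReD (x y : R[i]) : complex.Re (x + y) = complex.Re x + complex.Re y.
  exact: raddfD.
have ImD (x y : R[i]) : complex.Im (x + y) = complex.Im x + complex.Im y.
  exact: raddfD.
pose ReF t := complex.Re (F t); pose ImF t := complex.Im (F t).
pose ReG t := complex.Re (G t); pose ImG t := complex.Im (G t).
split.
  have -> : (fun t => complex.Re (F t * G t)) = ReF * ReG - ImF * ImG.
    by apply/funext => t; rewrite ReM.
  rewrite ReD !ReM.
  apply: (is_derive_eq (is_deriveB (is_deriveM Fr Gr) (is_deriveM Fi Gi))).
   rewrite /ReF /ImF /ReG /ImG.
  by rewrite /GRing.scale /=; ring.
have -> : (fun t => complex.Im (F t * G t)) = ReF * ImG + ImF * ReG.
  by apply/funext => t; rewrite ImM.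
rewrite ImD !ImM.
apply: (is_derive_eq (is_deriveD (is_deriveM Fr Gi) (is_deriveM Fi Gr))).
rewrite /ReF /ImF /ReG /ImG.
by rewrite /GRing.scale /=; ring.
Qed.

Lemma derives0_sum (I : finType) (F : I -> R -> R[i]) (d : I -> R[i]) :
  (forall j, derives0 (F j) (d j)) ->
  derives0 (fun t => \sum_j F j t) (\sum_j d j).
Proof.
move=> Fd; elim: (index_enum I) => [|j s IHs].
  rewrite big_nil; have -> : (fun t => \sum_(j <- [::]) F j t) = (fun=> 0).
    by apply/funext => t; rewrite big_nil.
  exact: derives0_cst.
rewrite big_cons; have -> : (fun t => \sum_(k <- j :: s) F k t)
    = (fun t => F j t + \sum_(k <- s) F k t).
  by apply/funext => t; rewrite big_cons.
exact: derives0D.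
Qed.

Lemma derives0_near F G d e : (\forall t \near (0 : R), F t = G t) ->
  derives0 F d -> derives0 G e -> d = e.
Proof.
move=> FG [Fr Fi] [Gr Gi].
have dr : complex.Re d = complex.Re e.
  rewrite -(@derive_val _ _ _ _ _ _ _ Fr) -(@derive_val _ _ _ _ _ _ _ Gr).
  by apply: near_eq_derive; near do congr (complex.Re _).
have di : complex.Im d = complex.Im e.
  rewrite -(@derive_val _ _ _ _ _ _ _ Fi) -(@derive_val _ _ _ _ _ _ _ Gi).
  by apply: near_eq_derive; near do congr (complex.Im _).
by move: dr di; case: (d) (e) => ? ? [? ?] /= -> ->.
Unshelve. all: by end_near. Qed.

(** Turns a Taylor expansion with quadratic remainder into a derivative. *)
Lemma is_derive_quadratic (g : R -> R) (d k : R) :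
  (\forall t \near (0 : R), `|g t - (g 0 + d * t)| <= k * t ^+ 2) ->
  is_derive (0 : R) (1 : R) g d.
Proof.
move=> gd.
have qd : (fun h : R => h^-1 *: ((g \o shift 0) (h *: (1 : R)) - g 0)) @ 0^' --> d.
  apply/cvgrPdist_le => e e0.
  have pos : 0 < (`|k| + 1)^-1 * e by rewrite mulr_gt0// invr_gt0 ltr_wpDl.
  near=> h.
  have h0 : h != 0 by near: h; exact: nbhs_dnbhs_neq.
  rewrite /= addr0 scaler1 -[X in X - _](mulKf h0) -mulrBr normrM distrC.
  rewrite normfV ler_pdivrMl ?normr_gt0//.
  have -> : g h - g 0 - h * d = g h - (g 0 + d * h) by ring.
  apply: (@le_trans _ _ (k * h ^+ 2)).
    by near: h; apply: nbhs_dnbhs.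
  rewrite -real_normK ?num_real// expr2 mulrCA ler_wpM2l//.
  apply: (@le_trans _ _ ((`|k| + 1) * `|h|)).
    by rewrite ler_wpM2r// (le_trans (ler_norm k))// lerDl.
  rewrite -ler_pdivlMl ?ltr_wpDl//.
  by near: h; exact: (@dnbhs0_le R R^o).
split; last exact: cvg_lim qd.
by apply/cvg_ex; exists d.
Unshelve. all: by end_near. Qed.

Lemma nbhs0_complexP (P : set R[i]) :
  nbhs (0 : R[i]^o) P ->
  exists2 e : R, 0 < e & forall z : R[i], `|z| < e%:C -> P z.
Proof.
rewrite -nbhs_ballE => -[e /= e0 eP].
move: (e0); rewrite ltcE /= => /andP[/eqP ime re0].
exists (complex.Re e) => // z ze; apply: eP; rewrite -ball_normE /ball_ /=.
by rewrite sub0r normrN; move: ime ze; case: (e) => a b /= ->.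
Qed.

Lemma normc_real (t : R) : `|t%:C| = `|t|%:C.
Proof. by rewrite normc_def /= expr0n addr0 sqrtr_sqr. Qed.

Lemma nbhs0_real_complex (P : set R[i]) :
  nbhs (0 : R[i]^o) P -> \forall t \near (0 : R), P t%:C.
Proof.
move=> /nbhs0_complexP[e e0 eP]; near=> t; apply: eP; rewrite normc_real ltcR.
by near: t; exact: (@nbhs0_lt R R^o).
Unshelve. all: by end_near. Qed.

Lemma normc_le (x y : R) : `|x +i* y| <= (`|x| + `|y|)%:C.
Proof.
have -> : x +i* y = x%:C + 'i * y%:C by simpc.
apply: (le_trans (ler_normD _ _)); rewrite normrM !normc_real.
rewrite (_ : `|'i : R[i]| = 1) ?mul1r ?rmorphD //.
by rewrite normc_def /= expr0n expr1n add0r sqrtr1.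
Qed.

Lemma normc_ge_Im (z : R[i]) : `|complex.Im z|%:C <= `|z|.
Proof.
case: z => x y; rewrite normc_def lecR /= -sqrtr_sqr ler_sqrt ?addr_ge0 ?sqr_ge0//.
by rewrite lerDr sqr_ge0.
Qed.

End ComplexCurves.

(** * Differentials in charts and on the twistor space *)

Section Charts.
Variables (R : realType) (n : nat) (M : smoothManifold R n).
Implicit Types (a : chart_index M) (p : M) (U : set M) (f g : M -> R[i]).

Lemma chart_inv_continuous_at a p :
  dom a p -> {for chart a p, continuous (chart_inv a)}.
Proof.
move=> ap; have := @chart_inv_continuous _ _ M a.
rewrite continuous_open_subspace; last exact: image_open.
by apply; rewrite inE; exists p.
Qed.

Lemma near_chart a p U : open U -> U p -> dom a p ->
  \forall x \near chart a p, (chart a @` dom a) x /\ U (chart_inv a x).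
Proof.
move=> oU Up ap; near=> x; split; near: x.
  by apply: open_nbhs_nbhs; split; [exact: image_open|exists p].
apply: chart_inv_continuous_at => //; rewrite /= chartK//.
by apply: open_nbhs_nbhs; split.
Unshelve. all: by end_near. Qed.

Lemma diff_in_eq a p U f g : open U -> U p -> dom a p ->
  (forall q, U q -> f q = g q) -> diff_in a f p = diff_in a g p.
Proof.
move=> oU Up ap fg; apply/rowP => i; rewrite !mxE.
congr (_ +i* _); apply: near_eq_derive; near=> x; rewrite /reF /imF /in_chart;
  rewrite fg//; have : (chart a @` dom a) x /\ U (chart_inv a x);
  solve [by near: x; exact: near_chart|by case].
Unshelve. all: by end_near. Qed.

Lemma csmooth_derivable a p U f i : csmooth U f -> U p -> dom a p ->
  derivable (reF (in_chart a f)) (chart a p) (delta_mx 0 i) /\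
  derivable (imF (in_chart a f)) (chart a p) (delta_mx 0 i).
Proof.
move=> /(_ a)[sr si] Up ap.
have im : (chart a @` (U `&` dom a)) (chart a p) by exists p.
by split; [exact: (sr [::] _ im).2|exact: (si [::] _ im).2].
Qed.

Lemma diff_in_conj a p U f : csmooth U f -> U p -> dom a p ->
  diff_in a (fun q => (f q)^*) p = conj_mx (diff_in a f p).
Proof.
move=> sf Up ap.
have reE : reF (in_chart a (fun q => (f q)^*)) = reF (in_chart a f).
  by apply/funext => x; rewrite /reF /in_chart; case: (f _).
have imE : imF (in_chart a (fun q => (f q)^*)) = - imF (in_chart a f).
  apply/funext => x; change (complex.Im (f (chart_inv a x))^*
    = - complex.Im (f (chart_inv a x))).
  by case: (f _).
apply/rowP => i; have [_ di] := csmooth_derivable i sf Up ap.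
by rewrite !mxE reE imE /partial (deriveN di).
Qed.

End Charts.

Section TwistorDifferentials.
Variables (R : realType) (m : nat) (M : smoothManifold R (4 * m)).
Variable H : hyperkahler M.
Implicit Types (a : chart_index M) (p : M) (h : M -> R[i] -> R[i]).
Implicit Types (zeta : R[i]) (V : set (M * R[i])).

Definition zeta_direction : 'I_(4 * m + (1 + 1)) :=
  rshift (4 * m) (lshift 1 (0 : 'I_1)).

Lemma twistor_pointK (x : 'rV[R]_(4 * m)) zeta :
  twistor_base (twistor_point x zeta) = x /\
  twistor_zeta (twistor_point x zeta) = zeta.
Proof.
rewrite /twistor_base /twistor_zeta /twistor_point row_mxKl !row_mxKr row_mxKl.
by split => //; rewrite !mxE /= !mulr1n; case: zeta.
Qed.

Lemma twistor_point_base (x : 'rV[R]_(4 * m)) zeta i (s : R) :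
  s *: delta_mx 0 (lshift (1 + 1) i) + twistor_point x zeta
  = twistor_point (s *: delta_mx 0 i + x) zeta.
Proof.
have -> : delta_mx 0 (lshift (1 + 1) i) = row_mx (delta_mx 0 i) 0 :> 'rV[R]_(4 * m + (1 + 1)).
  apply/rowP => j; case: (split_ordP j) => k ->; rewrite ?row_mxEl ?row_mxEr !mxE.
    by rewrite (inj_eq (@lshift_inj _ _)).
  by rewrite eq_rlshift andbF.
by rewrite /twistor_point scale_row_mx add_row_mx scaler0 add0r.
Qed.

Lemma twistor_point_zeta (x : 'rV[R]_(4 * m)) (t : R) :
  twistor_point x 0 + t *: delta_mx 0 zeta_direction = twistor_point x t%:C.
Proof.
apply/rowP => j; rewrite !mxE; case: (split_ordP j) => k ->.
  by rewrite ?row_mxEl /zeta_direction eq_lrshift andbF mulr0 addr0.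
rewrite ?row_mxEr /zeta_direction (inj_eq (@rshift_inj _ _)).
case: (split_ordP k) => l ->; rewrite ?row_mxEl ?row_mxEr !ord1 !mxE.
  by rewrite eqxx !mulr1n mulr1 add0r.
by rewrite eq_rlshift mulr0 addr0.
Qed.

Lemma partial_base (G : 'rV[R]_(4 * m + (1 + 1)) -> R) x zeta i :
  partial (lshift (1 + 1) i) G (twistor_point x zeta)
  = partial i (fun y => G (twistor_point y zeta)) x.
Proof.
have quotE : (fun s : R => s^-1 *: ((G \o shift (twistor_point x zeta))
      (s *: delta_mx 0 (lshift (1 + 1) i)) - G (twistor_point x zeta)))
    = (fun s : R => s^-1 *: (((fun y => G (twistor_point y zeta)) \o shift x)
      (s *: delta_mx 0 i) - G (twistor_point x zeta))).
  by apply/funext => s /=; rewrite twistor_point_base.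
by rewrite /partial /derive quotE.
Qed.

Lemma twistor_in_chartE a h x zeta :
  twistor_in_chart a h (twistor_point x zeta) = in_chart a (h ^~ zeta) x.
Proof. by have [bE zE] := twistor_pointK x zeta; rewrite /twistor_in_chart bE zE. Qed.

Lemma twistor_d_base a h p zeta :
  lsubmx (twistor_d a h p zeta) = diff_in a (h ^~ zeta) p.
Proof.
have reE : (fun y => reF (twistor_in_chart a h) (twistor_point y zeta))
    = reF (in_chart a (h ^~ zeta)).
  by apply/funext => y; rewrite /reF twistor_in_chartE.
have imE : (fun y => imF (twistor_in_chart a h) (twistor_point y zeta))
    = imF (in_chart a (h ^~ zeta)).
  by apply/funext => y; rewrite /imF twistor_in_chartE.
by apply/rowP => i; rewrite !mxE !partial_base reE imE.
Qed.

(** At zeta = 0, the point (0, 0, 1) of the sphere, the M-block of the twistor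
    structure is I_3. *)
Lemma twistor_holomorphic_zero V h a p :
  twistor_holomorphic H V h -> dom a p -> V (p, 0) ->
  diff_in a (h ^~ 0) p *m cmx (I3 H a p) = 'i *: diff_in a (h ^~ 0) p.
Proof.
move=> [_ holo] ap Vp.
have s0 : sphere_coord 0 0 1 = 0 :> R[i].
  by rewrite /sphere_coord (_ : 0 +i* 0 = 0) // mul0r oppr0.
have unit_sphere : 0 ^+ 2 + 0 ^+ 2 + 1 ^+ 2 = 1 :> R.
  by rewrite expr0n /= expr1n !add0r.
have not_pole : (1 : R) != -1.
  by rewrite -subr_eq0 opprK (_ : 1 + 1 = 2%:R) // pnatr_eq0.
have := holo a p 0 0 1 unit_sphere not_pole ap; rewrite s0 => /(_ Vp).
move/(congr1 lsubmx); rewrite linearZ /= twistor_d_base => <-.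
rewrite -[X in _ = lsubmx (X *m _)]hsubmxK twistor_d_base.
rewrite /twistor_structure /cmx map_block_mx mul_row_block row_mxKl.
rewrite map_mx0 mulmx0 addr0; congr (_ *m _).
by rewrite !scale0r !add0r scale1r.
Qed.

Definition twistor_domain a V : set 'rV[R]_(4 * m + (1 + 1)) :=
  [set y | (chart a @` dom a) (twistor_base y) /\
           V (chart_inv a (twistor_base y), twistor_zeta y)].

Lemma twistor_domain_nbhs a V p :
  open (V : set (M * (R[i])^o)) -> V (p, 0) -> dom a p ->
  nbhs (twistor_point (chart a p) 0) (twistor_domain a V).
Proof.
move=> oV Vp ap.
have : nbhs ((p, 0) : M * R[i]^o) (V : set (M * R[i]^o)).
  by apply: open_nbhs_nbhs; split.
move=> [[A B] /= [Ap B0] ABV].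
have [e2 e20 eB] := nbhs0_complexP B0.
have oA : open (A^°) by exact: open_interior.
have /nbhs_ballP[e1 /= e10 eA] : nbhs (chart a p) (fun x =>
    (chart a @` dom a) x /\ A^° (chart_inv a x)) by exact: near_chart.
pose e := Num.min e1 (e2 / 2).
have e0 : 0 < e by rewrite lt_min e10 divr_gt0.
apply/nbhs_ballP; exists e => //= y [_ ye].
have base_ball : ball (chart a p) e1 (twistor_base y).
  split=> // i j; rewrite mxE !ord1; have := ye 0 (lshift _ j).
  rewrite row_mxEl -!ball_normE /ball_ /= => /lt_le_trans; apply.
  by rewrite /e ge_min lexx.
have small l : ball (twistor_point (chart a p) 0 0 (rshift _ l)) e
    (y 0 (rshift (4 * m) l)) by exact: ye.
have [im Aq] := eA _ base_ball; split=> //.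
apply: ABV; split => /=; first exact: interior_subset Aq.
apply: eB; rewrite /twistor_zeta !mxE.
have := small (rshift 1 0); have := small (lshift 1 0).
rewrite !row_mxEr row_mxEl !mxE /= ?mul0rn -!ball_normE /ball_ /= !sub0r !normrN.
have half : e <= e2 / 2 by rewrite /e ge_min lexx orbT.
move=> /lt_le_trans/(_ half) lt1 /lt_le_trans/(_ half) lt2.
by apply: (le_lt_trans (normc_le _ _)); rewrite ltcR (splitr e2) ltrD.
Qed.

Lemma taylor1_value U h c0 c1 p : taylor1 U h c0 c1 -> U p -> h p 0 = c0 p.
Proof.
move=> tay Up; have /eqO_exP[K K0 /nbhs_singleton /=] := tay p Up.
rewrite mulr0 addr0 expr0n normr0 mulr0 normr_le0 subr_eq0.
by move=> /eqP.
Qed.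

Lemma taylor1_derives0 U h c0 c1 p : taylor1 U h c0 c1 -> U p ->
  derives0 (fun t => h p t%:C) (c1 p).
Proof.
move=> tay Up; have h0 := taylor1_value tay Up.
have /eqO_exP[K K0 near_le] := tay p Up.
have bound : \forall t \near (0 : R),
    `|h p t%:C - (h p 0 + c1 p * t%:C)| <= (complex.Re K * t ^+ 2)%:C.
  have := nbhs0_real_complex near_le; apply: filterS => t /= le_t.
  rewrite h0; apply: le_trans le_t _.
  move: K0; rewrite ltcE /= => /andP[/eqP imK _].
  have -> : K = (complex.Re K)%:C by move: imK; case: (K) => k1 k2 /= ->.
  by rewrite normrX normc_real -rmorphXn -rmorphM real_normK ?num_real.
have linR (x y z : R[i]) (t : R) : complex.Re (x - (y + z * t%:C))
    = complex.Re x - (complex.Re y + complex.Re z * t).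
  by case: x y z => ? ? [? ?] [? ?]; simpc.
have linI (x y z : R[i]) (t : R) : complex.Im (x - (y + z * t%:C))
    = complex.Im x - (complex.Im y + complex.Im z * t).
  by case: x y z => ? ? [? ?] [? ?]; simpc.
split; apply: (@is_derive_quadratic _ _ _ (complex.Re K));
  apply: filterS bound => t; rewrite -lecR; apply: le_trans.
  by rewrite -linR normc_ge_Re.
by rewrite -linI normc_ge_Im.
Qed.

Lemma partial_zeta (G : 'rV[R]_(4 * m + (1 + 1)) -> R) x :
  partial zeta_direction G (twistor_point x 0)
  = 'D_(1 : R) (fun t : R => G (twistor_point x t%:C)) (0 : R).
Proof.
have quotE : (fun s : R => s^-1 *: ((G \o shift (twistor_point x 0))
      (s *: delta_mx 0 zeta_direction) - G (twistor_point x 0)))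
    = (fun s : R => s^-1 *: (((fun t : R => G (twistor_point x t%:C)) \o shift 0)
      (s *: (1 : R)) - G (twistor_point x (0 : R)%:C))).
  by apply/funext => s /=; rewrite (addrC (s *: _)) twistor_point_zeta addr0 scaler1.
by rewrite /partial /derive quotE.
Qed.

(** The coefficient B of zeta in G is the partial derivative of G in the
    real zeta-direction, so differentiating B along M exchanges the order of
    two partial derivatives of G. *)
Lemma derive_taylor_coef (W : set 'rV[R]_(4 * m + (1 + 1)))
    (G : 'rV[R]_(4 * m + (1 + 1)) -> R) (B : 'rV[R]_(4 * m) -> R) x i :
  nbhs (twistor_point x 0) W -> smooth_on W G ->
  (\forall y \near x,
     is_derive (0 : R) (1 : R) (fun t : R => G (twistor_point y t%:C)) (B y)) ->
  is_derive (0 : R) (1 : R)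
    (fun t : R => partial i (fun y => G (twistor_point y t%:C)) x)
    (partial i B x).
Proof.
move=> nW sG dG.
pose T := zeta_direction; pose L := lshift (1 + 1) i.
have Wx := nbhs_singleton nW.
have dLG : derivable (partial L G) (twistor_point x 0 + (0 : R) *: delta_mx 0 T)
    (delta_mx 0 T).
  by rewrite scale0r addr0; exact: (sG [:: L] _ Wx).2.
have := is_derive_line dLG.
have -> : (fun t : R => partial L G (twistor_point x 0 + t *: delta_mx 0 T))
    = (fun t : R => partial i (fun y => G (twistor_point y t%:C)) x).
  by apply/funext => t; rewrite twistor_point_zeta partial_base.
rewrite scale0r addr0 => /is_derive_eq; apply.
transitivity (partial L (partial T G) (twistor_point x 0)).
  apply: derive_comm; last 2 first.
  - exact: (sG [:: T; L] _ Wx).1.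
  - exact: (sG [:: L; T] _ Wx).1.
  apply: filterS nW => y Wy; split.
  - exact: (sG [::] _ Wy).2.
  - exact: (sG [::] _ Wy).2.
  - exact: (sG [:: L] _ Wy).2.
  - exact: (sG [:: T] _ Wy).2.
rewrite partial_base; apply: near_eq_derive.
by apply: filterS dG => y dy; rewrite partial_zeta; apply: derive_val.
Qed.

Lemma diff_in_derives0 U V h c0 c1 a p i :
  open U -> open (V : set (M * (R[i])^o)) -> U p -> V (p, 0) -> dom a p ->
  twistor_holomorphic H V h -> taylor1 U h c0 c1 ->
  derives0 (fun t => diff_in a (h ^~ t%:C) p 0 i) (diff_in a c1 p 0 i).
Proof.
move=> oU oV Up Vp ap [/(_ a)[sr si] _] tay.
have nW := twistor_domain_nbhs oV Vp ap.
have nU := near_chart oU Up ap.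
have ReE (f : M -> R[i]) :
    complex.Re (diff_in a f p 0 i) = partial i (reF (in_chart a f)) (chart a p).
  by rewrite mxE.
have ImE (f : M -> R[i]) :
    complex.Im (diff_in a f p 0 i) = partial i (imF (in_chart a f)) (chart a p).
  by rewrite mxE.
split; rewrite ?ReE ?ImE.
  have -> : (fun t : R => complex.Re (diff_in a (h ^~ t%:C) p 0 i))
      = (fun t : R => partial i (fun y =>
           reF (twistor_in_chart a h) (twistor_point y t%:C)) (chart a p)).
    by apply/funext => t; rewrite -twistor_d_base [lsubmx _ _ _]mxE
      [twistor_d _ _ _ _ _ _]mxE /= partial_base.
  apply: derive_taylor_coef nW sr _; apply: filterS nU => y [_ Uy].
  have [dr _] := taylor1_derives0 tay Uy.
  by under eq_fun do rewrite /reF twistor_in_chartE.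
have -> : (fun t : R => complex.Im (diff_in a (h ^~ t%:C) p 0 i))
    = (fun t : R => partial i (fun y =>
         imF (twistor_in_chart a h) (twistor_point y t%:C)) (chart a p)).
  by apply/funext => t; rewrite -twistor_d_base [lsubmx _ _ _]mxE
      [twistor_d _ _ _ _ _ _]mxE /= partial_base.
apply: derive_taylor_coef nW si _; apply: filterS nU => y [_ Uy].
have [_ di] := taylor1_derives0 tay Uy.
by under eq_fun do rewrite /imF twistor_in_chartE.
Qed.

End TwistorDifferentials.

(** * The Darboux identity to first order *)

Section DarbouxExpansion.
Variables (R : realType) (m : nat) (M : smoothManifold R (4 * m)).
Variables (H : hyperkahler M) (U : set M) (S : special_functions H U).
Variables (a : chart_index M) (p : M).
Hypotheses (Up : U p) (ap : dom a p).

Definition differentials (F : 'I_m -> M -> R[i]) : 'M[R[i]]_(m, 4 * m) :=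
  \matrix_(A, j) diff_in a (F A) p 0 j.

Lemma sum_wedgeE (F G : 'I_m -> M -> R[i]) i j :
  (\sum_A wedge (diff_in a (F A) p) (diff_in a (G A) p)) i j =
  \sum_A (diff_in a (F A) p 0 i * diff_in a (G A) p 0 j
          - diff_in a (G A) p 0 i * diff_in a (F A) p 0 j).
Proof.
rewrite summxE; apply: eq_bigr => A _; rewrite /wedge.
move: (diff_in a (F A) p) (diff_in a (G A) p) => x y.
by rewrite !mxE !big_ord1 !mxE.
Qed.

Lemma skew_productE (F G : 'I_m -> M -> R[i]) i j :
  ((differentials F)^T *m differentials G
   - (differentials G)^T *m differentials F) i j =
  \sum_A (diff_in a (F A) p 0 i * diff_in a (G A) p 0 j
          - diff_in a (G A) p 0 i * diff_in a (F A) p 0 j).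
Proof.
rewrite !mxE -sumrB; apply: eq_bigr => A _; rewrite /differentials.
by move: (fun A => diff_in a (F A) p) (fun A => diff_in a (G A) p) => x y; rewrite !mxE.
Qed.

Let Vp : sc_V S (p, 0). Proof. exact: sc_U_sub. Qed.

Lemma diff_eta0 A : diff_in a (eta S A ^~ 0) p = diff_in a (sz S A) p.
Proof.
apply: (diff_in_eq (sc_U_open S)) => // q Uq.
exact: taylor1_value (eta_taylor S A) Uq.
Qed.

Lemma diff_etat0 A : diff_in a (etat S A ^~ 0) p = diff_in a (su S A) p.
Proof.
apply: (diff_in_eq (sc_U_open S)) => // q Uq.
exact: taylor1_value (etat_taylor S A) Uq.
Qed.

Lemma differentials_holomorphic :
  differentials (sz S) *m Izero H a p = 'i *: differentials (sz S).
Proof.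
apply/row_matrixP => A; rewrite row_mul linearZ /=.
have -> : row A (differentials (sz S)) = diff_in a (sz S A) p.
  by apply/rowP => j; rewrite [LHS]mxE [LHS]mxE.
rewrite -diff_eta0; exact: twistor_holomorphic_zero (eta_holomorphic S A) ap Vp.
Qed.

Lemma omega_plus_darboux : omega_plus H a p =
  (differentials (su S))^T *m differentials (sz S)
  - (differentials (sz S))^T *m differentials (su S).
Proof.
have := darboux ap Vp; rewrite scale0r expr0n scale0r !addr0 => <-.
apply/matrixP => i j; rewrite sum_wedgeE skew_productE.
by apply: eq_bigr => A _; rewrite diff_eta0 diff_etat0.
Qed.

(** Both sides of the Darboux identity are differentiated at zeta = 0 along
    the real axis. *)
Lemma omega_zero_darboux : omega_zero H a p =
  (differentials (su S))^T *m differentials (sv S)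
  - (differentials (sv S))^T *m differentials (su S)
  + ((differentials (sw S))^T *m differentials (sz S)
     - (differentials (sz S))^T *m differentials (sw S)).
Proof.
have nV : \forall t \near (0 : R), sc_V S (p, t%:C).
  have : nbhs ((p, 0) : M * R[i]^o) (sc_V S : set (M * R[i]^o)).
    by apply: open_nbhs_nbhs; split; [exact: sc_V_open|exact: Vp].
  move=> [[A B] /= [Ap B0] ABV].
  have := nbhs0_real_complex B0; apply: filterS => t Bt.
  by apply: ABV; split => //; exact: nbhs_singleton.
have oU := sc_U_open S; have oV := @sc_V_open _ _ _ _ _ S.
pose et A i t := diff_in a (eta S A ^~ t%:C) p 0 i.
pose tt A i t := diff_in a (etat S A ^~ t%:C) p 0 i.
have d_et A i : derives0 (et A i) (diff_in a (sv S A) p 0 i).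
  exact: diff_in_derives0 oU oV Up Vp ap (eta_holomorphic S A) (eta_taylor S A).
have d_tt A i : derives0 (tt A i) (diff_in a (sw S A) p 0 i).
  exact: diff_in_derives0 oU oV Up Vp ap (etat_holomorphic S A) (etat_taylor S A).
have et0 A i : et A i 0 = diff_in a (sz S A) p 0 i by rewrite -diff_eta0.
have tt0 A i : tt A i 0 = diff_in a (su S A) p 0 i by rewrite -diff_etat0.
have addmxE (A B : 'M[R[i]]_(4 * m)) i j : (A + B) i j = A i j + B i j.
  by rewrite mxE.
apply/matrixP => i j; rewrite [RHS]addmxE !skew_productE -big_split /=.
have left_der : derives0
    (fun t => \sum_A (tt A i t * et A j t - et A i t * tt A j t)) _ :=
  derives0_sum (fun A => derives0B (derives0M (d_tt A i) (d_et A j))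
                                   (derives0M (d_et A i) (d_tt A j))).
have right_der : derives0 (fun t : R => omega_plus H a p i j
    + (t%:C * omega_zero H a p i j + t%:C * t%:C * omega_minus H a p i j)) _ :=
  derives0D (derives0_cst _) (derives0D
    (derives0M (derives0_real R) (derives0_cst _))
    (derives0M (derives0M (derives0_real R) (derives0_real R)) (derives0_cst _))).
have agree : \forall t \near (0 : R),
    \sum_A (tt A i t * et A j t - et A i t * tt A j t) =
    omega_plus H a p i j
    + (t%:C * omega_zero H a p i j + t%:C * t%:C * omega_minus H a p i j).
  apply: filterS nV => t Vt; rewrite /tt /et -sum_wedgeE (darboux ap Vt).
  move: (omega_plus H a p) (omega_zero H a p) (omega_minus H a p) => w1 w2 w3.
  by rewrite !addmxE !mxE addrA.
have := derives0_near agree left_der right_der.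
rewrite mul1r !mulr0 !mul0r !addr0 !add0r mul0r addr0 => <-.
by apply: eq_bigr => A _; rewrite !et0 !tt0; ring.
Qed.

End DarbouxExpansion.

(** * Coordinate frames *)

Section Frames.
Variables (R : realType) (m : nat) (M : smoothManifold R (4 * m)).
Variables (Y : 'M[M -> R[i]]_(4, m)) (a : chart_index M) (p : M).
Hypothesis Y_unit : coframe Y a p \in unitmx.

Definition coord_differentials (b : 'I_4) : 'M[R[i]]_(m, 4 * m) :=
  differentials a p (Y b).

Definition coord_frame (b : 'I_4) : 'M[R[i]]_(4 * m, m) :=
  \matrix_(j, A) coord_vf Y b A a p j 0.

Lemma coframeE b A j :
  coframe Y a p (mxvec_index b A) j = coord_differentials b A j.
Proof. by rewrite !mxE [mxvec _ _ _]mxvecE. Qed.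

Lemma coord_frame_dual b c :
  coord_differentials b *m coord_frame c = (b == c)%:R%:M.
Proof.
apply/matrixP => A B.
have := congr1 (fun C : 'M[R[i]]_(4 * m) => C (mxvec_index b A) (mxvec_index c B))
  (mulmxV Y_unit).
rewrite /= [LHS]mxE [1%:M _ _]mxE => dual.
have index_eq : (mxvec_index b A == mxvec_index c B) = (b == c) && (A == B).
  by rewrite (inj_eq (@cast_ord_inj _ _ _)) (inj_eq enum_rank_inj).
rewrite [RHS]mxE; transitivity (((b == c) && (A == B))%:R : R[i]); last first.
  by case: (b == c); case: (A == B); rewrite ?mulr1n ?mulr0n.
rewrite -index_eq -dual [LHS]mxE; apply: eq_bigr => j _.
by rewrite coframeE [coord_frame _ _ _]mxE [coord_vf _ _ _ _ _ _ _]mxE.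
Qed.

Lemma coord_frame_decomposition r (X : 'M[R[i]]_(4 * m, r)) :
  X = \sum_b coord_frame b *m (coord_differentials b *m X).
Proof.
rewrite -[LHS]mul1mx -(mulVmx Y_unit) -mulmxA.
pose C := invmx (coframe Y a p); rewrite -/C.
apply/matrixP => j l; rewrite mxE summxE.
rewrite (reindex _ (curry_mxvec_bij _ _)) /=.
transitivity (\sum_(q : 'I_4 * 'I_m) C j (mxvec_index q.1 q.2) *
    (coframe Y a p *m X) (mxvec_index q.1 q.2) l).
  by apply: eq_big => [[b A]|[b A] _].
rewrite -(pair_bigA _ (fun b A => C j (mxvec_index b A) *
   (coframe Y a p *m X) (mxvec_index b A) l)) /=.
apply: eq_bigr => b _; rewrite mxE; apply: eq_bigr => A _.
congr (_ * _); first by rewrite [RHS]mxE [RHS]mxE.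
by rewrite !mxE; apply: eq_bigr => k _; rewrite coframeE.
Qed.

Lemma coord_frame_unique b (X : 'M[R[i]]_(4 * m, m)) :
  (forall c, coord_differentials c *m X = (c == b)%:R%:M) -> X = coord_frame b.
Proof.
move=> dX; rewrite [LHS]coord_frame_decomposition [RHS]coord_frame_decomposition.
by apply: eq_bigr => c _; rewrite dX coord_frame_dual.
Qed.

Lemma coord_pdE b A f :
  coord_pd Y b A a f p = (diff_in a f p *m coord_frame b) 0 A.
Proof.
rewrite /coord_pd [LHS]mxE [RHS]mxE; apply: eq_bigr => j _.
by congr (_ * _); rewrite [RHS]mxE.
Qed.

Lemma col_coord_frame b A : col A (coord_frame b) = coord_vf Y b A a p.
Proof. by apply/colP => j; rewrite [LHS]mxE [LHS]mxE. Qed.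

End Frames.

Section FourGroups.
Variables (R : realType) (m : nat) (M : smoothManifold R (4 * m)).

Lemma group_cases (b : 'I_4) : [\/ b = grp0, b = grp1, b = grp2 | b = grp3].
Proof.
case: b => -[|[|[|[|//]]]] lt4; [apply: Or41|apply: Or42|apply: Or43|apply: Or44];
  by apply/val_inj; rewrite /= inordK.
Qed.

Lemma tnth_group (T : Type) (x0 x1 x2 x3 : T) :
  [/\ tnth [tuple x0; x1; x2; x3] grp0 = x0, tnth [tuple x0; x1; x2; x3] grp1 = x1,
      tnth [tuple x0; x1; x2; x3] grp2 = x2 & tnth [tuple x0; x1; x2; x3] grp3 = x3].
Proof. by rewrite !(tnth_nth x0) /= !inordK. Qed.

Lemma groups_uniq : uniq [:: grp0; grp1; grp2; grp3].
Proof. by rewrite /= !inE -!val_eqE /= !inordK. Qed.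

Lemma four_coordsE (y0 y1 y2 y3 : 'I_m -> M -> R[i]) A :
  [/\ four_coords y0 y1 y2 y3 grp0 A = y0 A,
      four_coords y0 y1 y2 y3 grp1 A = y1 A,
      four_coords y0 y1 y2 y3 grp2 A = y2 A
    & four_coords y0 y1 y2 y3 grp3 A = y3 A].
Proof.
have [E0 E1 E2 E3] := tnth_group y0 y1 y2 y3.
by rewrite !mxE E0 E1 E2 E3.
Qed.

Lemma differentialsE a p (F : 'I_m -> M -> R[i]) A j :
  differentials a p F A j = diff_in a (F A) p 0 j.
Proof. by rewrite mxE. Qed.

Lemma differentials_eq a p (F G : 'I_m -> M -> R[i]) :
  (forall A, F A = G A) -> differentials a p F = differentials a p G.
Proof. by move=> FG; apply/matrixP => A j; rewrite !mxE FG. Qed.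

Lemma differentials_conj a p U (F G : 'I_m -> M -> R[i]) :
  open U -> U p -> dom a p -> (forall A, csmooth U (F A)) ->
  (forall A q, U q -> G A q = (F A q)^*) ->
  conj_mx (differentials a p F) = differentials a p G.
Proof.
move=> oU Up ap sF GF; apply/matrixP => A j; rewrite [LHS]mxE !differentialsE.
rewrite (diff_in_eq oU Up ap (GF A)) (diff_in_conj (sF A) Up ap).
by rewrite [RHS]mxE.
Qed.

End FourGroups.

(** * Gradients along the leaf *)

Section LeafwiseGradient.
Variables (R : realType) (m : nat) (M : smoothManifold R (4 * m)).
Variables (H : hyperkahler M) (U : set M) (S : special_functions H U).
Variables (a : chart_index M) (p : M).
Hypotheses (Up : U p) (ap : dom a p).

Let dz := differentials a p (sz S).
Let du := differentials a p (su S).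
Let dv := differentials a p (sv S).
Let G : 'M[R[i]]_(4 * m) := cmx (metric H a p).
Let w0 := omega_zero H a p.

Lemma omega_zero_restriction k l (Q : 'M[R[i]]_(4 * m, k))
    (T : 'M[R[i]]_(4 * m, l)) : dz *m Q = 0 -> dz *m T = 0 ->
  Q^T *m w0 *m T = (du *m Q)^T *m (dv *m T) - (dv *m Q)^T *m (du *m T).
Proof.
move=> dzQ dzT; rewrite /w0 (omega_zero_darboux S Up ap).
exact: skew_pullback_kernel dzQ dzT.
Qed.

Variables (Q : 'M[R[i]]_(4 * m, m + m)) (L : 'M[R[i]]_(m + m, 4 * m)).
Hypothesis dzQ : dz *m Q = 0.
Hypothesis dzbarQ : conj_mx dz *m Q = 0.
Hypothesis QL : forall r (X : 'M[R[i]]_(4 * m, r)),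
  dz *m X = 0 -> conj_mx dz *m X = 0 -> X = Q *m (L *m X).
Hypothesis LQ : L *m Q = 1%:M.

Lemma metric_posdef (X : 'cV[R[i]]_(4 * m)) :
  (conj_mx X)^T *m G *m X = 0 -> X = 0.
Proof.
have [gT gpos] := metric_riemannian H ap.
exact: sesquilinear_posdef gT gpos X.
Qed.

Lemma metric_omega : [/\ G *m Iplus H a p = omega_plus H a p,
  G *m Izero H a p = w0 & G *m Iminus H a p = omega_minus H a p].
Proof.
have := metric_compatible H ap.
rewrite -/(I1 H a p) -/(I2 H a p) -/(I3 H a p).
rewrite /omega_plus /w0 /omega_zero /omega_minus /Iplus /Izero /Iminus.
move: (I1 H a p) (I2 H a p) (I3 H a p) => i1 i2 i3 [-> -> ->].
rewrite !cmxM; split => //; rewrite -scalemxAr; congr (_ *: _).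
  by rewrite mulmxDr -scalemxAr.
by rewrite mulmxBr -scalemxAr.
Qed.

Let K1 : 'M[R[i]]_(4 * m) := cmx (I1 H a p).
Let K2 : 'M[R[i]]_(4 * m) := cmx (I2 H a p).
Let K3 : 'M[R[i]]_(4 * m) := cmx (I3 H a p).

Lemma quaternionic_complexified : [/\ K1 *m K1 = - 1%:M, K2 *m K2 = - 1%:M,
  K3 *m K3 = - 1%:M & K1 *m K2 *m K3 = - 1%:M].
Proof.
by have [q1 q2 q3 q4] := quaternionic H ap; split; rewrite -!cmxM ?q1 ?q2 ?q3 ?q4
  cmxN cmx1.
Qed.

Lemma omega_zero_leaf_inj (x : 'cV[R[i]]_(m + m)) :
  x^T *m (Q^T *m w0 *m Q) = 0 -> x = 0.
Proof.
have [_ w0E _] := metric_omega; have [_ _ k3 _] := quaternionic_complexified.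
have GT : G^T = G by have [gT _] := metric_riemannian H ap; rewrite /G -cmxT gT.
move=> x0; apply: (omega_zero_leaf_nondegenerate GT metric_posdef
  (conj_cmx (I3 H a p)) k3 (differentials_holomorphic S Up ap) dzQ dzbarQ QL LQ).
by rewrite -[X in _ *m X *m _]/(G *m Izero H a p) w0E trmx_mul -x0 !mulmxA.
Qed.

(** Applies to every gradient along the leaf: by the second hypothesis the
    contraction of X_l with omega_0 agrees with d_l on F. *)
Lemma leafwise_gradient_chainP (d : int -> 'rV[R[i]]_(4 * m))
    (X : int -> 'cV[R[i]]_(4 * m)) (x : int -> 'cV[R[i]]_(m + m)) :
  (forall l, X l = Q *m x l) ->
  (forall l, (x l)^T *m (Q^T *m w0 *m Q) = d l *m Q) ->
  (forall l : int, d (l - 1) *m Iplus H a p + d l *m Izero H a p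
             + d (l + 1) *m Iminus H a p = 0) <->
  (forall l : int, interior_product (X (l - 1)) (omega_plus H a p)
             + interior_product (X l) (omega_zero H a p)
             + interior_product (X (l + 1)) (omega_minus H a p) = d l).
Proof.
move=> XE xd; have [wpE w0E wmE] := metric_omega.
have [k1 k2 k3 k123] := quaternionic_complexified.
have ii := complex_ii R.
have two0 : 2 != 0 :> R[i] by rewrite pnatr_eq0.
have wm_conj : G *m Iminus H a p = - conj_mx (G *m Iplus H a p).
  rewrite wpE wmE /omega_plus /omega_minus.
  move: (omega1 H a p) (omega2 H a p) => w1 w2.
  by rewrite conj_ladder scaleNr.
have Xd l : (X l)^T *m (G *m Izero H a p) *m Q = d l *m Q.
  by rewrite w0E XE trmx_mul -xd !mulmxA.
have wpD : G *m Iplus H a p = du^T *m dz - dz^T *m du.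
  by rewrite wpE (omega_plus_darboux S Up ap).
have mmn : (m + m + (m + m) = 4 * m)%N by rewrite !mulSn mul0n addn0 -addnA.
have := leaf_gradient_chainP metric_posdef (conj_cmx (I3 H a p)) k3
  (up_J3 k1 k2 k3 k123 ii two0) (down_J3 k1 k2 k3 k123 ii two0)
  (J3_up k1 k2 k3 k123 ii two0) (J3_down k1 k2 k3 k123 ii two0)
  (up_up k1 k2 k3 k123 ii two0) (down_down k1 k2 k3 k123 ii two0)
  (up_down k1 k2 k3 k123 ii two0) wm_conj wpD
  (differentials_holomorphic S Up ap) dzQ dzbarQ QL LQ mmn XE Xd.
rewrite -[ladder_up _ _ _]/(Iplus H a p) -[ladder_down _ _ _]/(Iminus H a p).
by rewrite -[cmx (I3 H a p)]/(Izero H a p) wpE w0E wmE.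
Qed.
End LeafwiseGradient.

Section CoordinateLeaf.
Variables (R : realType) (m : nat) (M : smoothManifold R (4 * m)).
Variables (Y : 'M[M -> R[i]]_(4, m)) (U : set M).
Hypotheses (oU : open U) (Y_coord : coordinate_system Y U).
Variables (a : chart_index M) (p : M).
Hypotheses (Up : U p) (ap : dom a p).

Let Y_unit : coframe Y a p \in unitmx.
Proof. by have [_ + _] := Y_coord; apply. Qed.

Let dY b := coord_differentials Y a p b.
Let frame b := coord_frame Y a p b.

Lemma frame_same b : dY b *m frame b = 1%:M.
Proof. by rewrite /dY /frame coord_frame_dual// eqxx. Qed.

Lemma frame_other b c : b != c -> dY b *m frame c = 0.
Proof.
by move=> /negPf bc; rewrite /dY /frame coord_frame_dual// bc raddf0.
Qed.

Lemma differentials_conj_group b c :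
  (forall A q, U q -> Y c A q = (Y b A q)^*) -> conj_mx (dY b) = dY c.
Proof.
have [sY _ _] := Y_coord => bc.
by apply: (differentials_conj oU Up ap) => // A; exact: sY.
Qed.

(** The dual frame is unique, so conjugation permutes the coordinate fields in
    the way it permutes the coordinates. *)
Lemma frame_conj (s : 'I_4 -> 'I_4) : involutive s ->
  (forall b A q, U q -> Y (s b) A q = (Y b A q)^*) ->
  forall b, conj_mx (frame b) = frame (s b).
Proof.
move=> sK conjY b; apply: coord_frame_unique => // c.
have -> : coord_differentials Y a p c = conj_mx (dY (s c)).
  by rewrite (differentials_conj_group (conjY (s c))) sK.
rewrite -conj_mxM /dY /frame coord_frame_dual//.
have -> : (s c == b) = (c == s b) by rewrite -(inj_eq (can_inj sK)) sK.
by case: (c == s b); rewrite ?conj_mx1 // raddf0 conj_mx0.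
Qed.

(* The groups b1, b2 are constant along the leaf, c1, c2 coordinates on it. *)
Variables (b1 b2 c1 c2 : 'I_4).
Hypothesis groups : uniq [:: b1; b2; c1; c2].

Definition leaf_frame := row_mx (frame c1) (frame c2).
Definition leaf_coframe := col_mx (dY c1) (dY c2).

Lemma leaf_frame_kernel b : b \in [:: b1; b2] -> dY b *m leaf_frame = 0.
Proof.
move: groups; rewrite /= !inE !negb_or.
move=> /and4P[/and3P[_ n1 n2] /andP[n3 n4] _ _] /orP[] /eqP->;
  by rewrite /leaf_frame mul_mx_row !frame_other// row_mx0.
Qed.

Lemma leaf_coframeK : leaf_coframe *m leaf_frame = 1%:M.
Proof.
move: groups; rewrite /= !inE => /and4P[_ _ c12 _].
rewrite /leaf_coframe /leaf_frame mul_col_row !frame_same.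
by rewrite !frame_other ?(eq_sym c2)// -scalar_mx_block.
Qed.

Lemma leaf_frame_span r (X : 'M[R[i]]_(4 * m, r)) :
  dY b1 *m X = 0 -> dY b2 *m X = 0 -> X = leaf_frame *m (leaf_coframe *m X).
Proof.
move=> X1 X2; rewrite /leaf_frame /leaf_coframe mul_col_mx mul_row_col.
rewrite [LHS](coord_frame_decomposition Y_unit).
have all_groups b : b \in [:: b1; b2; c1; c2].
  have cardE : #|[:: b1; b2; c1; c2]| = #|'I_4| by rewrite (card_uniqP groups) card_ord.
  by have /(subset_cardP cardE)-> := subset_predT (mem [:: b1; b2; c1; c2]).
transitivity (\sum_(b <- [:: b1; b2; c1; c2]) frame b *m (dY b *m X)).
  by rewrite [RHS]big_uniq //; apply: eq_bigl => b; rewrite all_groups.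
rewrite 4!big_cons big_nil X1 X2 !mulmx0 !add0r.
by rewrite [X in _ + X = _]addr0.
Qed.

End CoordinateLeaf.

(** Common setting of the two types: b1, b2 are z and its conjugate, and c1 is
    the group v, so that omega_0 = du_A /\ dv^A on F has only two blocks
    besides the one that [leaf_lagrangian] assumes to vanish. *)
Section DarbouxLeaf.
Variables (R : realType) (m : nat) (M : smoothManifold R (4 * m)).
Variables (H : hyperkahler M) (U : set M) (S : special_functions H U).
Variables (Y : 'M[M -> R[i]]_(4, m)) (a : chart_index M) (p : M).
Hypotheses (Y_coord : coordinate_system Y U) (Up : U p) (ap : dom a p).
Variables (b1 b2 c1 c2 : 'I_4).
Hypothesis groups : uniq [:: b1; b2; c1; c2].

Let dz := differentials a p (sz S).
Let du := differentials a p (su S).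
Let dY b := coord_differentials Y a p b.
Let frame b := coord_frame Y a p b.
Hypothesis dY_z : dY b1 = dz.
Hypothesis dY_zbar : dY b2 = conj_mx dz.
Hypothesis dY_v : dY c1 = differentials a p (sv S).

Let P := du *m frame c2.
Hypothesis leaf_lagrangian : (frame c1)^T *m omega_zero H a p *m frame c1 = 0.

Let Q := leaf_frame Y a p c1 c2.
Let L := leaf_coframe Y a p c1 c2.

Let dzQ : dz *m Q = 0.
Proof. by rewrite -dY_z; apply: (leaf_frame_kernel Y_coord) groups _ _; rewrite ?inE ?eqxx. Qed.
Let dzbarQ : conj_mx dz *m Q = 0.
Proof. by rewrite -dY_zbar; apply: (leaf_frame_kernel Y_coord) groups _ _; rewrite ?inE ?eqxx ?orbT. Qed.
Let QL r (X : 'M[R[i]]_(4 * m, r)) :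
  dz *m X = 0 -> conj_mx dz *m X = 0 -> X = Q *m (L *m X).
Proof.
move=> zX zbX; apply: (leaf_frame_span Y_coord Up ap groups).
  by rewrite -/(dY b1) dY_z.
by rewrite -/(dY b2) dY_zbar.
Qed.
Let LQ : L *m Q = 1%:M.
Proof. exact: (leaf_coframeK Y_coord Up ap groups). Qed.

Let dz_frame1 : dz *m frame c1 = 0.
Proof.
rewrite -dY_z; apply: (frame_other Y_coord Up ap).
by move: groups; rewrite /= !inE !negb_or => /andP[/and3P[]].
Qed.

Let dv_frames : dY c1 *m frame c1 = 1%:M /\ dY c1 *m frame c2 = 0.
Proof.
split; first exact: (frame_same Y_coord Up ap).
apply: (frame_other Y_coord Up ap).
by move: groups; rewrite /= !inE => /and4P[].
Qed.

Lemma omega_zero_leaf_block :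
  Q^T *m omega_zero H a p *m Q = block_mx 0 (- P) P^T 0.
Proof.
have [v1 v2] := dv_frames.
have sym : (du *m frame c1)^T - du *m frame c1 = 0.
  rewrite -leaf_lagrangian (omega_zero_restriction Up ap dz_frame1 dz_frame1) -dY_v v1.
  by rewrite trmx1 mulmx1 mul1mx.
rewrite (omega_zero_restriction Up ap dzQ dzQ) -dY_v.
have -> : dY c1 *m Q = row_mx 1%:M 0 by rewrite /Q /leaf_frame mul_mx_row v1 v2.
rewrite -/du [du *m Q]mul_mx_row -/(frame c1) -/(frame c2) -/P.
rewrite !tr_row_mx !mul_col_row trmx1 trmx0 !mulmx0 !mul0mx !mulmx1 !mul1mx.
by rewrite opp_block_mx add_block_mx sym !sub0r !subr0 oppr0.
Qed.

(** A vector of the span of the c2-fields in the kernel of P would be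
    omega_0-orthogonal to F. *)
Lemma leaf_pairing_unit : P \in unitmx.
Proof.
rewrite -unitmx_tr -row_free_unit; apply: inj_row_free => c cP.
have : (col_mx 0 c^T : 'cV_(m + m))^T *m (Q^T *m omega_zero H a p *m Q) = 0.
  rewrite omega_zero_leaf_block tr_col_mx trmxK trmx0 mul_row_block.
  by rewrite !mul0mx mulmx0 cP !add0r row_mx0.
move/(omega_zero_leaf_inj Up ap dzQ dzbarQ QL LQ)/(congr1 dsubmx).
by rewrite col_mxKd linear0 => /(congr1 trmx); rewrite trmxK trmx0.
Qed.

(** The inverse on F of contraction with omega_0, in the block form of
    [omega_zero_leaf_block]. *)
Definition darboux_gradient (d : 'rV[R[i]]_(4 * m)) : 'cV[R[i]]_(4 * m) :=
  frame c2 *m (invmx P *m (d *m frame c1)^T)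
  - frame c1 *m ((invmx P)^T *m (d *m frame c2)^T).

Lemma darboux_gradient_chainP (d : int -> 'rV[R[i]]_(4 * m)) :
  (forall l : int, d (l - 1) *m Iplus H a p + d l *m Izero H a p
             + d (l + 1) *m Iminus H a p = 0) <->
  (forall l : int,
     interior_product (darboux_gradient (d (l - 1))) (omega_plus H a p)
     + interior_product (darboux_gradient (d l)) (omega_zero H a p)
     + interior_product (darboux_gradient (d (l + 1))) (omega_minus H a p) = d l).
Proof.
pose x l : 'cV[R[i]]_(m + m) := col_mx (- ((invmx P)^T *m (d l *m frame c2)^T))
                     (invmx P *m (d l *m frame c1)^T).
apply: (leafwise_gradient_chainP Up ap dzQ dzbarQ QL LQ (x := x)) => l.
  by rewrite /x /Q /leaf_frame mul_row_col mulmxN addrC.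
rewrite omega_zero_leaf_block /x tr_col_mx mul_row_block !mulmx0 addr0 add0r.
have -> (c : 'cV[R[i]]_m) : (- c)^T *m - P = c^T *m P.
  by rewrite mulmxN [(- c)^T]linearN mulNmx opprK.
rewrite -!trmx_mul !trmxK mulmxKV ?mulKVmx ?leaf_pairing_unit // trmxK.
by rewrite [RHS]mul_mx_row.
Qed.

End DarbouxLeaf.

(** * The two types of special coordinates *)

Section SpecialCoordinateTypes.
Variables (R : realType) (m : nat) (M : smoothManifold R (4 * m)).
Variables (H : hyperkahler M) (U : set M) (S : special_functions H U).
Variables (a : chart_index M) (p : M).
Hypotheses (Up : U p) (ap : dom a p).

Let dz := differentials a p (sz S).
Let du := differentials a p (su S).

Lemma omega_zero_real : conj_mx (omega_zero H a p) = omega_zero H a p.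
Proof. exact: conj_cmx. Qed.

Lemma conj_pullback k (Q : 'M[R[i]]_(4 * m, k)) :
  conj_mx (Q^T *m omega_zero H a p *m Q)
  = (conj_mx Q)^T *m omega_zero H a p *m conj_mx Q.
Proof. by rewrite !conj_mxM omega_zero_real conj_mxT. Qed.

Section Type1.
Hypothesis S1 : is_type1 S.
Let Y := coords1 S.

Let Y_coord : coordinate_system Y U. Proof. by case: S1. Qed.

Let YE A : [/\ Y grp0 A = sz S A, Y grp1 A = sv S A, Y grp2 A = szbar S A
  & Y grp3 A = svbar S A].
Proof. exact: four_coordsE. Qed.

Lemma type1_differentials : [/\ coord_differentials Y a p grp0 = dz,
  coord_differentials Y a p grp2 = conj_mx dz &
  coord_differentials Y a p grp1 = differentials a p (sv S)].
Proof.
have z0 : coord_differentials Y a p grp0 = dz.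
  by apply: differentials_eq => A; have [] := YE A.
split=> //; last by apply: differentials_eq => A; have [] := YE A.
rewrite -z0; symmetry.
apply: (differentials_conj_group (sc_U_open S) Y_coord Up ap) => A q _.
by have [-> _ -> _] := YE A.
Qed.

Lemma type1_frame_conj :
  conj_mx (coord_frame Y a p grp1) = coord_frame Y a p grp3.
Proof.
pose s b := tnth [tuple grp2; grp3; grp0; grp1] b.
have [s0 s1 s2 s3] := tnth_group grp2 grp3 grp0 grp1.
rewrite -[in RHS]s1; apply: (frame_conj (s := s) (sc_U_open S) Y_coord Up ap).
  by move=> b; case: (group_cases b) => ->; rewrite /s ?s0 ?s1 ?s2 ?s3.
move=> b A q _; have [Y0 Y1 Y2 Y3] := YE A; rewrite /s.
by case: (group_cases b) => ->; rewrite ?(s0, s1, s2, s3) ?(Y0, Y1, Y2, Y3)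
  /szbar /svbar ?conjcK.
Qed.

Let frame b := coord_frame Y a p b.

Lemma type1_kernel b : b != grp0 -> dz *m frame b = 0.
Proof.
have [<- _ _] := type1_differentials => b0.
by apply: (frame_other Y_coord Up ap); rewrite eq_sym.
Qed.

(** Since dv and dz kill the fields d/dvbar, omega_0 vanishes between them; its
    reality carries this over to the conjugate fields d/dv. *)
Lemma type1_lagrangian : (frame grp1)^T *m omega_zero H a p *m frame grp1 = 0.
Proof.
move: groups_uniq; rewrite /= !inE !negb_or => /and4P[/and3P[n01 n02 n03] /andP[n12 n13] n23 _].
have dz3 : dz *m frame grp3 = 0 by apply: type1_kernel; rewrite eq_sym.
have dv3 : differentials a p (sv S) *m frame grp3 = 0.
  have [_ _ <-] := type1_differentials.
  exact: (frame_other Y_coord Up ap).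
rewrite -[LHS]conj_mxK conj_pullback type1_frame_conj.
rewrite (omega_zero_restriction Up ap dz3 dz3) dv3.
by rewrite mulmx0 trmx0 mul0mx subrr conj_mx0.
Qed.

Lemma rhoE : rho S a p = - 'i *: (du *m frame grp3).
Proof.
apply/matrixP => A B; rewrite [LHS]mxE [RHS]mxE coord_pdE; congr (_ * _).
rewrite [LHS]mxE [RHS]mxE; apply: eq_bigr => j _.
by rewrite /du differentialsE.
Qed.

Lemma type1_groups : uniq [:: grp0; grp2; grp1; grp3].
Proof.
rewrite -(perm_uniq (s1 := [:: grp0; grp1; grp2; grp3])) ?groups_uniq //.
by rewrite perm_cons (perm_catCA [:: grp1] [:: grp2] [:: grp3]).
Qed.

(** The prefactor i of X_f and the factor -i in rho cancel up to the sign
    that orders the two terms. *)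
Lemma X1E f : X1 S a f p = darboux_gradient S Y a p grp1 grp3 (diff_in a f p).
Proof.
have [dY0 dY2 dY1] := type1_differentials.
have P_unit := leaf_pairing_unit Y_coord Up ap type1_groups dY0 dY2 dY1
  type1_lagrangian.
have rho_unit : rho S a p \in unitmx.
  by rewrite rhoE unitmxZ// unitfE oppr_eq0 eq_complex /= oner_eq0 andbF.
have inv_rho : invmx (rho S a p) = 'i *: invmx (du *m frame grp3).
  apply: (can_inj (mulKmx rho_unit)); rewrite mulmxV// rhoE -scalemxAl.
  by rewrite -scalemxAr scalerA mulNr complex_ii opprK scale1r mulmxV.
have XE : X1 S a f p = 'i *: \sum_A \sum_B invmx (rho S a p) A B *:
    ((diff_in a f p *m frame grp3) 0 A *: col B (frame grp1)
     - (diff_in a f p *m frame grp1) 0 B *: col A (frame grp3)).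
  apply: (congr1 (fun X => 'i *: X)).
  apply: eq_bigr => A _; apply: eq_bigr => B _.
  by rewrite !coord_pdE !col_coord_frame.
rewrite XE bivector_contraction inv_rho /darboux_gradient -/du.
rewrite linearZ /= -!scalemxAl -!scalemxAr -scalerBr scalerA complex_ii.
by rewrite scaleN1r opprB.
Qed.

Lemma type1_gradient_chainP (f : int -> M -> R[i]) :
  (forall l : int, diff_in a (f (l - 1)) p *m Iplus H a p
     + diff_in a (f l) p *m Izero H a p
     + diff_in a (f (l + 1)) p *m Iminus H a p = 0) <->
  (forall l : int, interior_product (X1 S a (f (l - 1)) p) (omega_plus H a p)
     + interior_product (X1 S a (f l) p) (omega_zero H a p)
     + interior_product (X1 S a (f (l + 1)) p) (omega_minus H a p)
     = diff_in a (f l) p).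
Proof.
have [dY0 dY2 dY1] := type1_differentials.
have := darboux_gradient_chainP Y_coord Up ap type1_groups dY0 dY2 dY1 type1_lagrangian
  (fun l => diff_in a (f l) p).
move=> ->; split=> h l; have := h l; by rewrite !X1E.
Qed.

End Type1.

Section Type2.
Variable varrho : 'I_m -> M -> R.
Hypothesis S2 : is_type2 S varrho.
Let Y := coords2 S varrho.

Let Y_coord : coordinate_system Y U. Proof. by case: S2. Qed.

Let YE A : [/\ Y grp0 A = sz S A, Y grp1 A = szbar S A, Y grp2 A = sv S A
  & Y grp3 A = psit S varrho A].
Proof. exact: four_coordsE. Qed.

Let frame b := coord_frame Y a p b.
Let dvarrho := differentials a p (varrhoC varrho).

Lemma type2_differentials : [/\ coord_differentials Y a p grp0 = dz,
  coord_differentials Y a p grp1 = conj_mx dz,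
  coord_differentials Y a p grp2 = differentials a p (sv S)
  & coord_differentials Y a p grp3 = differentials a p (psit S varrho)].
Proof.
have z0 : coord_differentials Y a p grp0 = dz.
  by apply: differentials_eq => A; have [] := YE A.
split=> //; try by apply: differentials_eq => A; have [] := YE A.
rewrite -z0; symmetry.
apply: (differentials_conj_group (sc_U_open S) Y_coord Up ap) => A q _.
by have [-> -> _ _] := YE A.
Qed.

Lemma type2_frame_conj : conj_mx (frame grp2) = frame grp2 /\
  conj_mx (frame grp3) = frame grp3.
Proof.
have [v_real _ _ _] := S2.
pose s b := tnth [tuple grp1; grp0; grp2; grp3] b.
have [s0 s1 s2 s3] := tnth_group grp1 grp0 grp2 grp3.
have sK : involutive s.
  by move=> b; case: (group_cases b) => ->; rewrite /s ?s0 ?s1 ?s2 ?s3.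
have conjY b A q : U q -> Y (s b) A q = (Y b A q)^*.
  move=> Uq; have [Y0 Y1 Y2 Y3] := YE A; rewrite /s.
  case: (group_cases b) => ->; rewrite ?(s0, s1, s2, s3) ?(Y0, Y1, Y2, Y3)
    /szbar /psit ?conjcK ?conjc_real//.
  by have := v_real A q Uq; case: (sv S A q) => x y /= ->; rewrite oppr0.
have fr := frame_conj (sc_U_open S) Y_coord Up ap sK conjY.
by split; rewrite /frame fr /s ?s2 ?s3.
Qed.

(** Re u_A is the sum of the coordinate \tilde psi_A and of varrho_A. *)
Lemma du_real_part :
  du + conj_mx du = 2 *: (differentials a p (psit S varrho) + dvarrho).
Proof.
have [sY _ _] := Y_coord; have [_ _ _ [svr _ _]] := S2.
apply/matrixP => A j.
have psi_smooth : csmooth U (psit S varrho A).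
  by have [_ _ _ <-] := YE A; exact: sY.
have [dpsi _] := csmooth_derivable j psi_smooth Up ap.
have [dvr _] := csmooth_derivable j (svr A) Up ap.
have reE : reF (in_chart a (su S A))
    = reF (in_chart a (psit S varrho A)) + reF (in_chart a (varrhoC varrho A)).
  by apply/funext => x; rewrite /= /reF /in_chart /= subrK.
have imE (h : M -> R) : partial j (imF (in_chart a (fun q => (h q)%:C))) (chart a p) = 0.
  have -> : imF (in_chart a (fun q => (h q)%:C)) = cst 0 by apply/funext.
  by rewrite /partial derive_cst.
have dE (f : M -> R[i]) : diff_in a f p 0 j = partial j (reF (in_chart a f)) (chart a p)
    +i* partial j (imF (in_chart a f)) (chart a p) by rewrite mxE.
rewrite [LHS]mxE [conj_mx _ _ _]mxE [RHS]mxE [(_ + dvarrho) _ _]mxE.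
rewrite /du /dvarrho !differentialsE !dE !imE reE {1 3}/partial (deriveD dpsi dvr).
rewrite -/(partial j (reF (in_chart a (psit S varrho A))) (chart a p)).
rewrite -/(partial j (reF (in_chart a (varrhoC varrho A))) (chart a p)).
move: (partial j _ _) (partial j _ _) (partial j _ _) => x y z.
rewrite mulr_natl mulr2n; simpc.
by congr (_ +i* _); ring.
Qed.

Let groups : uniq [:: grp0; grp1; grp2; grp3] := groups_uniq.

Lemma type2_kernel : [/\ dz *m frame grp2 = 0, dz *m frame grp3 = 0,
  differentials a p (sv S) *m frame grp2 = 1%:M &
  differentials a p (sv S) *m frame grp3 = 0].
Proof.
move: groups_uniq; rewrite /= !inE !negb_or.
move=> /and4P[/and3P[n01 n02 n03] /andP[n12 n13] n23 _].
have [<- _ <- _] := type2_differentials.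
split; try exact: (frame_other Y_coord Up ap).
exact: (frame_same Y_coord Up ap).
Qed.

Lemma type2_psit : differentials a p (psit S varrho) *m frame grp2 = 0 /\
  differentials a p (psit S varrho) *m frame grp3 = 1%:M.
Proof.
move: groups_uniq; rewrite /= !inE !negb_or.
move=> /and4P[/and3P[n01 n02 n03] /andP[n12 n13] n23 _].
have [_ _ _ <-] := type2_differentials.
split; last exact: (frame_same Y_coord Up ap).
by apply: (frame_other Y_coord Up ap); rewrite eq_sym.
Qed.

Lemma dvarrhoE b A B :
  (dvarrho *m frame b) A B = coord_pd Y b B a (varrhoC varrho A) p.
Proof.
rewrite coord_pdE [LHS]mxE [RHS]mxE; apply: eq_bigr => j _.
by rewrite /dvarrho differentialsE.
Qed.

(** The coordinate fields are real, so omega_0 takes real values on them and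
    du may be replaced by d Re u, where dpsit drops out; what is left is the
    antisymmetric part of the psi-derivatives of varrho. *)
Lemma type2_lagrangian : (frame grp2)^T *m omega_zero H a p *m frame grp2 = 0.
Proof.
have [dz2 _ dv2 _] := type2_kernel; have [fr2 _] := type2_frame_conj.
have two0 : 2 != 0 :> R[i] by rewrite pnatr_eq0.
have gramE : (frame grp2)^T *m omega_zero H a p *m frame grp2
    = (du *m frame grp2)^T - du *m frame grp2.
  rewrite (omega_zero_restriction Up ap dz2 dz2) dv2.
  by rewrite trmx1 mulmx1 mul1mx.
have gram_real := conj_pullback (frame grp2).
rewrite fr2 gramE in gram_real; rewrite gramE.
have dvr_sym : (dvarrho *m frame grp2)^T = dvarrho *m frame grp2.
  apply/matrixP => A B; rewrite [LHS]mxE !dvarrhoE.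
  by have [_ _ _ [_ _ sym]] := S2; apply: sym.
have sumE : du *m frame grp2 + conj_mx (du *m frame grp2)
    = 2 *: (dvarrho *m frame grp2).
  have [psi2 _] := type2_psit.
  rewrite conj_mxM fr2 -mulmxDl du_real_part -scalemxAl mulmxDl psi2.
  by rewrite add0r.
apply: (scalerI two0); rewrite scaler0 scaler_nat mulr2n.
rewrite -{1}gram_real conj_mxB conj_mxT addrC addrACA -opprD sumE.
by rewrite -linearD /= sumE linearZ /= dvr_sym subrr.
Qed.

(** By reality only d Re u contributes, and varrho does not depend on the
    coordinates \tilde psi. *)
Lemma type2_pairing : du *m frame grp3 = 1%:M.
Proof.
have [dz2 dz3 dv2 dv3] := type2_kernel; have [fr2 fr3] := type2_frame_conj.
have two0 : 2 != 0 :> R[i] by rewrite pnatr_eq0.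
have gramE : (frame grp3)^T *m omega_zero H a p *m frame grp2
    = (du *m frame grp3)^T.
  rewrite (omega_zero_restriction Up ap dz3 dz2) dv2 dv3.
  by rewrite trmx0 mulmx1 mul0mx subr0.
have real3 : conj_mx (du *m frame grp3) = du *m frame grp3.
  apply: (can_inj (@trmxK _ _ _)); rewrite -conj_mxT -gramE.
  by rewrite !conj_mxM conj_mxT fr2 fr3 omega_zero_real.
have dvr3 : dvarrho *m frame grp3 = 0.
  apply/matrixP => A B; rewrite dvarrhoE [RHS]mxE.
  by have [_ _ _ [_ indep _]] := S2; apply: indep.
have [_ psi3] := type2_psit.
apply: (scalerI two0); rewrite scaler_nat mulr2n -{2}real3 conj_mxM fr3.
by rewrite -mulmxDl du_real_part -scalemxAl mulmxDl psi3 dvr3 addr0.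
Qed.

Lemma X2E f : X2 S varrho a f p
  = darboux_gradient S Y a p grp2 grp3 (diff_in a f p).
Proof.
have -> : X2 S varrho a f p = \sum_A ((diff_in a f p *m frame grp2) 0 A *: col A (frame grp3)
     - (diff_in a f p *m frame grp3) 0 A *: col A (frame grp2)).
  by apply: eq_bigr => A _; rewrite !coord_pdE !col_coord_frame.
rewrite /darboux_gradient -/du type2_pairing invmx1 trmx1 !mul1mx.
rewrite !mulmx_col_combination sumrB.
by congr (_ - _); apply: eq_bigr => A _; rewrite [(_)^T _ _]mxE.
Qed.

Lemma type2_gradient_chainP (f : int -> M -> R[i]) :
  (forall l : int, diff_in a (f (l - 1)) p *m Iplus H a p
     + diff_in a (f l) p *m Izero H a p
     + diff_in a (f (l + 1)) p *m Iminus H a p = 0) <->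
  (forall l : int, interior_product (X2 S varrho a (f (l - 1)) p) (omega_plus H a p)
     + interior_product (X2 S varrho a (f l) p) (omega_zero H a p)
     + interior_product (X2 S varrho a (f (l + 1)) p) (omega_minus H a p)
     = diff_in a (f l) p).
Proof.
have [dY0 dY1 dY2 _] := type2_differentials.
have := darboux_gradient_chainP Y_coord Up ap groups dY0 dY1 dY2 type2_lagrangian
  (fun l => diff_in a (f l) p).
by move=> ->; split=> h l; have := h l; rewrite !X2E.
Qed.

End Type2.
End SpecialCoordinateTypes.

Theorem proposition37 (R : realType) (m : nat) (M : smoothManifold R (4 * m))
    (H : hyperkahler M) (U : set M) (T : special_coordinates H U)
    (D : set M) (D_open : open D) (D_nonempty : D !=set0) (D_sub : D `<=` U)
    (f : int -> M -> R[i]) (f_diff : forall n, differentiable_fun D (f n)) :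
  hyperpotential_chain H D f <->
  (forall (n : int) (a : chart_index M) (p : M), D p -> dom a p ->
     interior_product (special_gradient T a (f (n - 1)) p) (omega_plus H a p)
     + interior_product (special_gradient T a (f n) p) (omega_zero H a p)
     + interior_product (special_gradient T a (f (n + 1)) p) (omega_minus H a p)
     = diff_in a (f n) p).
Proof.
case: T => [S S1|S varrho S2]; split=> eqs n a p Dp ap; have Up := D_sub p Dp.
- by apply: ((type1_gradient_chainP Up ap S1 f).1 _ n) => l; exact: eqs.
- by apply: ((type1_gradient_chainP Up ap S1 f).2 _ n) => l; exact: eqs.
- by apply: ((type2_gradient_chainP Up ap S2 f).1 _ n) => l; exact: eqs.
- by apply: ((type2_gradient_chainP Up ap S2 f).2 _ n) => l; exact: eqs.
Qed.
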